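(* $$\sum_{n=1}^{\infty}\frac{w^n}{n^p}\sum_{k=1}^{n}\binom{n}{k}\frac{(-1)^k x^k}{k^s}=\frac{(-1)^{s+1}x}{\Gamma(s+1)}\int_0^1\frac{\log^s t\;Li_{p-1}[w(1-xt)]}{1-xt}\,dt.$$
   Context: $Li_m(z)=\sum_{n=1}^{\infty}\frac{z^n}{n^m}$ denotes the polylogarithm, $\Gamma$ is the gamma function, and $\log^s t$ means $(\log t)^s$. *)

(* Defs.v *)
From HB Require Import structures.
From mathcomp Require Export all_boot all_order all_algebra.
From mathcomp Require Export all_classical all_reals all_analysis.
From mathcomp Require Export complex.

Set Implicit Arguments.
Unset Strict Implicit.
Unset Printing Implicit Defensive.

Import Order.TTheory GRing.Theory Num.Theory.
Import numFieldNormedType.Exports.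

Local Open Scope classical_set_scope.
Local Open Scope ring_scope.
Local Open Scope complex_scope.

(* The topology on the complex numbers is carried by the alias [R[i]^o]. *)
Definition csummable (R : realType) (u : nat -> R[i]) : Prop :=
  cvgn (fun N : nat => (\sum_(1 <= n < N) u n : R[i]^o)).

(* Series start at index 1; a divergent one has an unspecified value. *)
Definition csum (R : realType) (u : nat -> R[i]) : R[i] :=
  limn (fun N : nat => (\sum_(1 <= n < N) u n : R[i]^o)).

Definition polylog_term (R : realType) (m : int) (z : R[i]) (n : nat) : R[i] :=
  z ^+ n / n%:R ^ m.

Definition polylog (R : realType) (m : int) (z : R[i]) : R[i] :=
  csum (polylog_term m z).

(* Euler's integral, which converges for [0 < a]. *)
Definition Gamma (R : realType) (a : R) : R :=
  \int[lebesgue_measure]_(t in `]0, +oo[) (t `^ (a - 1) * expR (- t)).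

(* Lebesgue integration of complex-valued functions on [0, 1]. *)
Definition cintegrable01 (R : realType) (f : R -> R[i]) : Prop :=
  lebesgue_measure.-integrable `[0, 1] (fun t : R => (complex.Re (f t))%:E) /\
  lebesgue_measure.-integrable `[0, 1] (fun t : R => (complex.Im (f t))%:E).

Definition cintegral01 (R : realType) (f : R -> R[i]) : R[i] :=
  (\int[lebesgue_measure]_(t in `[0, 1]) complex.Re (f t))
    +i* (\int[lebesgue_measure]_(t in `[0, 1]) complex.Im (f t)).

Definition binomial_series_term (R : realType) (p : int) (s : nat)
    (w x : R[i]) (n : nat) : R[i] :=
  w ^+ n / n%:R ^ p *
  \sum_(1 <= k < n.+1) 'C(n, k)%:R * ((-1) ^+ k * x ^+ k / k%:R ^+ s).

(* The value at [t = 0], and at [t = x^-1] when [x] is real, is a convention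
   (ln 0 = 0, 0^-1 = 0) without effect on the integral. *)
Definition polylog_integrand (R : realType) (p : int) (s : nat)
    (w x : R[i]) (t : R) : R[i] :=
  (ln t ^+ s)%:C * polylog (p - 1) (w * (1 - x * t%:C)) / (1 - x * t%:C).

(* Main.v *)
Require Import Defs.
From HB Require Import structures.
From mathcomp Require Import all_boot all_order all_algebra.
From mathcomp Require Import all_classical all_reals all_analysis.
From mathcomp Require Import measurable_realfun complex.
From mathcomp Require Import ring lra zify.

Set Implicit Arguments.
Unset Strict Implicit.
Unset Printing Implicit Defensive.

Import Order.TTheory GRing.Theory Num.Theory.
Import numFieldNormedType.Exports.

Local Open Scope classical_set_scope.
Local Open Scope ring_scope.
Local Open Scope complex_scope.

(** Let [z(t) = w (1 - x t)] and [q = p - 1]. Term by term the identity is a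
    computation: the [n]th term of the binomial series is the constant on the
    right times the integral of [ln^s t] times the [n]th term of
    [Li_q(z(t)) / (1 - x t)] ([binomial_series_term_integral]). One expands
    [(1 - x t)^(n-1)] and uses
    [int_0^1 ln^s t t^j dt = (-1)^s s! / (j+1)^(s+1)] ([log_moment]) and
    [Gamma (s + 1) = s!] ([Gamma_nat]), which come from the same antiderivative.

    The point is to exchange the sum and the integral. Convergence of the
    polylogarithms gives [|z(t)| <= 1], hence [|z(t)| < 1] on [(0, 1)] by strict
    convexity of the disc ([segment_in_open_disc]), but [z] may reach the
    singularity [1] at an endpoint, where partial sums need not be dominated.
    So the [n]th terms are multiplied by [r^n] with [r < 1]. Then the exchange
    is an easy dominated convergence. Now let [r] tend to [1]. On the left,
    Abel's theorem ([abel_theorem]) recovers the sum of the convergent series.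
    On the right, Abel's theorem gives pointwise convergence of the integrands,
    and the dominating function comes from the integrable limit itself:
    [polylog_abel_dominated] says that for every integer [q] there is a [C] with
    [|sum r^n z^(n-1) / n^q| <= C (1 + |sum z^(n-1) / n^q|)] for all [|z| < 1]
    and [0 <= r < 1].

    That estimate has three cases. For [q >= 2] the left side is at most
    [sum 1 / n^2]. For [q <= 0] the series sums to a polynomial in
    [u = 1 / (1 - z)] ([power_sum_polynomials]); passing from [z] to [r z] at
    most doubles [|u|], and polynomials tolerate this ([poly_doubling]). For
    [q = 1], where the sum is a logarithm, the Abel mean is compared with the
    sum by summation by parts when [1 - r <= |1 - z|] ([order1_gap]), and
    otherwise increased first to that range by positivity of the coefficients
    ([order1_monotone]). *)

Local Notation mag := ComplexField.Normc.normc.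

(** * The modulus as a real number *)

Section Modulus.
Variable R : realType.
Implicit Types z w : R[i].

Lemma magE z : `|z| = (mag z)%:C. Proof. by []. Qed.

Lemma mag_ge0 z : 0 <= mag z.
Proof. by rewrite -ler0c -magE. Qed.

Lemma mag_real (a : R) : mag a%:C = `|a|.
Proof. by rewrite /= expr0n /= addr0 sqrtr_sqr. Qed.

Lemma mag0 : mag (0 : R[i]) = 0. Proof. exact: ComplexField.Normc.normc0. Qed.

Lemma mag1 : mag (1 : R[i]) = 1. Proof. exact: ComplexField.Normc.normc1. Qed.

Lemma mag_eq0 z : (mag z == 0) = (z == 0).
Proof.
apply/eqP/eqP => [|->]; [exact: ComplexField.Normc.eq0_normc | exact: mag0].
Qed.

Lemma magN z : mag (- z) = mag z.
Proof. by apply: complexI; rewrite -!magE normrN. Qed.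

Lemma mag_distC z w : mag (z - w) = mag (w - z).
Proof. by rewrite -magN opprB. Qed.

Lemma magM z w : mag (z * w) = mag z * mag w.
Proof. exact: ComplexField.Normc.normcM. Qed.

Lemma magX z n : mag (z ^+ n) = mag z ^+ n.
Proof. by elim: n => [|n IH]; rewrite ?expr0 ?mag1// !exprS magM IH. Qed.

Lemma magV z : mag z^-1 = (mag z)^-1.
Proof. exact: ComplexField.Normc.normcV. Qed.

Lemma magD z w : mag (z + w) <= mag z + mag w.
Proof. by rewrite -lecR rmorphD /= -!magE; exact: ler_normD. Qed.

Lemma magB z w : mag (z - w) <= mag z + mag w.
Proof. by rewrite -(magN w); exact: magD. Qed.

Lemma mag_sum (I : Type) (r : seq I) (P : pred I) (F : I -> R[i]) :
  mag (\sum_(i <- r | P i) F i) <= \sum_(i <- r | P i) mag (F i).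
Proof.
apply: (big_ind2 (fun (a : R[i]) b => mag a <= b)) => //; first by rewrite mag0.
by move=> a b c d ab cd; apply: le_trans (magD _ _) (lerD ab cd).
Qed.

Lemma normr_Re_le z : `|complex.Re z| <= mag z.
Proof. by rewrite -lecR -magE; exact: normc_ge_Re. Qed.

Lemma normr_Im_le z : `|complex.Im z| <= mag z.
Proof.
case: z => a b /=; rewrite -[leLHS]sqrtr_sqr ler_wsqrtr//.
by rewrite lerDr sqr_ge0.
Qed.

Lemma mag_le_ReIm z : mag z <= `|complex.Re z| + `|complex.Im z|.
Proof.
rewrite {1}[z]complexE; apply: le_trans (magD _ _) _.
by rewrite magM !mag_real /= expr0n expr1n add0r sqrtr1 mul1r.
Qed.

Lemma ReM_real (a : R) z : complex.Re (a%:C * z) = a * complex.Re z.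
Proof. by case: z => u v /=; rewrite mul0r subr0. Qed.

Lemma ImM_real (a : R) z : complex.Im (a%:C * z) = a * complex.Im z.
Proof. by case: z => u v /=; rewrite mul0r addr0. Qed.

Lemma Re_sum (I : Type) (r : seq I) (P : pred I) (F : I -> R[i]) :
  complex.Re (\sum_(i <- r | P i) F i) = \sum_(i <- r | P i) complex.Re (F i).
Proof. by elim/big_rec2: _ => // i a b _ <-; case: (F i) b => [? ?] []. Qed.

Lemma Im_sum (I : Type) (r : seq I) (P : pred I) (F : I -> R[i]) :
  complex.Im (\sum_(i <- r | P i) F i) = \sum_(i <- r | P i) complex.Im (F i).
Proof. by elim/big_rec2: _ => // i a b _ <-; case: (F i) b => [? ?] []. Qed.

End Modulus.

(** * Limits of complex sequences *)

Section ComplexLimits.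
Variable R : realType.
Implicit Types (f g u v : nat -> R[i]) (l : R[i]).

Lemma cvgC_dist f l :
  (f : nat -> R[i]^o) @ \oo --> (l : R[i]^o) <->
  (forall e : R, 0 < e -> \forall n \near \oo, mag (f n - l) < e).
Proof.
split=> [/cvgrPdist_lt h e e0|h].
  have /h : 0 < e%:C :> R[i] by rewrite ltcR.
  by apply: filterS => n; rewrite magE ltcR mag_distC.
apply/cvgrPdist_lt => e e0.
have [e1 e2] : (0 < complex.Re e) /\ e = (complex.Re e)%:C.
  by case: e e0 => a b; rewrite ltcE /= => /andP[/eqP -> ->].
apply: filterS (h _ e1) => n; rewrite e2 magE ltcR.
by rewrite mag_distC.
Qed.

Lemma cvgC_ReIm f l :
  (f : nat -> R[i]^o) @ \oo --> (l : R[i]^o) <->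
  (fun n => complex.Re (f n)) @ \oo --> complex.Re l /\
  (fun n => complex.Im (f n)) @ \oo --> complex.Im l.
Proof.
have ReB (a b : R[i]) : complex.Re a - complex.Re b = complex.Re (a - b).
  by case: a b => [? ?] [].
have ImB (a b : R[i]) : complex.Im a - complex.Im b = complex.Im (a - b).
  by case: a b => [? ?] [].
split=> [/cvgC_dist h|[hr hi]].
  split; apply/cvgrPdist_lt => e e0; apply: filterS (h _ e0) => n.
    by rewrite ReB mag_distC; apply: le_lt_trans (normr_Re_le _).
  by rewrite ImB mag_distC; apply: le_lt_trans (normr_Im_le _).
apply/cvgC_dist => e e0.
have e2 : 0 < e / 2 by rewrite divr_gt0.
move/cvgrPdist_lt: hr => /(_ _ e2) hr; move/cvgrPdist_lt: hi => /(_ _ e2) hi.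
near=> n; rewrite mag_distC; apply: le_lt_trans (mag_le_ReIm _) _.
rewrite -ReB -ImB (splitr e); apply: ltrD; near: n; [exact: hr|exact: hi].
Unshelve. all: by end_near. Qed.

Lemma cvgC_le f l (B : R) : (f : nat -> R[i]^o) @ \oo --> (l : R[i]^o) ->
  (\forall n \near \oo, mag (f n) <= B) -> mag l <= B.
Proof.
move=> /cvgC_dist h hB; apply/ler_addgt0Pr => e e0.
have [n [h1 h2]] : exists n, mag (f n) <= B /\ mag (f n - l) < e.
  have [N _ hN] : \forall n \near \oo, mag (f n) <= B /\ mag (f n - l) < e.
    by near=> n; split; near: n => //; exact: h.
  by exists N; apply: hN => /=.
rewrite -[l](subKr (f n)); apply: le_trans (magB _ _) _.
by rewrite lerD// ltW.
Unshelve. all: by end_near. Qed.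

Lemma cvgC_mag0 f l (b : nat -> R) : b @ \oo --> (0 : R) ->
  (\forall n \near \oo, mag (f n - l) <= b n) ->
  (f : nat -> R[i]^o) @ \oo --> (l : R[i]^o).
Proof.
move=> /cvgrPdist_lt b0 h; apply/cvgC_dist => e e0.
have {}b0 := b0 _ e0; near=> n.
have hn : mag (f n - l) <= b n by near: n.
apply: le_lt_trans hn _; apply: le_lt_trans (ler_norm _) _.
by rewrite -normrN -sub0r; near: n.
Unshelve. all: by end_near. Qed.

End ComplexLimits.

(** * Complex series and Abel's theorem *)

Section ComplexSeries.
Variable R : realType.
Implicit Types (u v : nat -> R[i]) (l : R[i]).

Definition csums u l :=
  (fun N : nat => (\sum_(1 <= n < N) u n : R[i]^o)) @ \oo --> (l : R[i]^o).

Lemma csumsP u : csummable u <-> csums u (csum u).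
Proof. by split=> [h|h]; [exact: h|apply/cvg_ex; exists (csum u)]. Qed.

Lemma csums_csum u l : csums u l -> csum u = l.
Proof.
by move=> h; apply: (@cvg_lim R[i]^o) h => //; exact: norm_hausdorff.
Qed.

Lemma csums_summable u l : csums u l -> csummable u.
Proof. by move=> h; apply/cvg_ex; exists l. Qed.

Lemma eq_csums u v l : (forall n, (0 < n)%N -> u n = v n) ->
  csums u l -> csums v l.
Proof.
rewrite /csums => uv; suff -> : (fun N => \sum_(1 <= n < N) u n) =
  (fun N => \sum_(1 <= n < N) v n) by [].
by apply/funext => N; apply: eq_big_nat => n /andP[n0 _]; exact: uv.
Qed.

Lemma csumsD u v l m : csums u l -> csums v m ->
  csums (fun n => u n + v n) (l + m).
Proof.
move=> hu hv; rewrite /csums; under eq_fun do rewrite big_split /=.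
exact: (@cvgD _ R[i]^o _ _ _ _ _ _ _ hu hv).
Qed.

Lemma csumsZ c u l : csums u l -> csums (fun n => c * u n) (c * l).
Proof.
move=> hu; rewrite /csums; under eq_fun do rewrite -mulr_sumr.
exact: (@cvgM R[i]^o _ _ _ _ _ _ _ (@cvg_cst R[i]^o c _ _ _) hu).
Qed.

Arguments csumsZ c {u l} _.

Lemma csumsB u v l m : csums u l -> csums v m ->
  csums (fun n => u n - v n) (l - m).
Proof.
move=> hu /(csumsZ (-1)); rewrite mulN1r => /(csumsD hu).
by apply: eq_csums => n _; rewrite mulN1r.
Qed.

Lemma csums_sum (I : Type) (s : seq I) (F : I -> nat -> R[i]) (L : I -> R[i]) :
  (forall i, csums (F i) (L i)) ->
  csums (fun n => \sum_(i <- s) F i n) (\sum_(i <- s) L i).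
Proof.
move=> h; elim: s => [|i s IH].
  rewrite big_nil; suff : csums (fun=> 0 : R[i]) 0.
    by apply: eq_csums => n _; rewrite big_nil.
  rewrite /csums; under eq_fun do rewrite big1 //.
  exact: (@cvg_cst R[i]^o 0 _ _ _).
rewrite big_cons; have := csumsD (h i) IH.
by apply: eq_csums => n _; rewrite big_cons.
Qed.

Lemma csums_le u l B : csums u l ->
  (forall N, mag (\sum_(1 <= n < N) u n) <= B) -> mag l <= B.
Proof. by move=> h hB; apply: (cvgC_le h); apply: nearW. Qed.

Lemma sum_bounded_cvg (a : nat -> R) B : (forall n, 0 <= a n) ->
  (forall N, \sum_(1 <= n < N) a n <= B) ->
  cvgn (fun N => \sum_(1 <= n < N) a n).
Proof.
move=> a0 aB; apply: nondecreasing_is_cvgn.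
  apply/nondecreasing_seqP => -[|n]; first by rewrite !big_geq.
  by rewrite [leRHS]big_nat_recr//= lerDl.
by exists B => _ [N _ <-].
Qed.

Lemma csummable_abs u B : (forall N, \sum_(1 <= n < N) mag (u n) <= B) ->
  csummable u.
Proof.
move=> uB; have key (f : nat -> R) : (forall n, `|f n| <= mag (u n)) ->
    cvgn (fun N => \sum_(1 <= n < N) f n).
  move=> fu.
  have -> : (fun N => \sum_(1 <= n < N) f n) =
      (fun N => \sum_(1 <= n < N) (`|f n| + f n)) -
      (fun N => \sum_(1 <= n < N) `|f n|).
    by apply/funext => N; rewrite !fctE -sumrB; apply: eq_bigr => n _; ring.
  apply: is_cvgB.
    apply: (@sum_bounded_cvg _ (B + B)) => n.
      by rewrite -lerBlDr sub0r -normrN ler_norm.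
    rewrite big_split /= lerD//; apply: le_trans (uB n); apply: ler_sum => i _.
      exact: fu.
    by apply: le_trans (fu i); exact: ler_norm.
  apply: (@sum_bounded_cvg _ B) => // N; apply: le_trans (uB N).
  by apply: ler_sum.
have /cvg_ex[a ha] := key _ (fun n => normr_Re_le (u n)).
have /cvg_ex[b hb] := key _ (fun n => normr_Im_le (u n)).
apply/cvg_ex; exists (a +i* b); apply/cvgC_ReIm; split.
  by under eq_fun do rewrite Re_sum.
by under eq_fun do rewrite Im_sum.
Qed.

Lemma cvgC_bounded (f : nat -> R[i]) l :
  (f : nat -> R[i]^o) @ \oo --> (l : R[i]^o) ->
  exists2 K : R, 0 <= K & forall n, mag (f n) <= K.
Proof.
move=> /cvgC_dist/(_ 1 ltr01)[N _ hN].
exists (mag l + 1 + \sum_(i < N) mag (f i)) => [|n].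
  by rewrite !addr_ge0 ?mag_ge0// sumr_ge0// => i _; exact: mag_ge0.
have s0 (P : pred 'I_N): 0 <= \sum_(i < N | P i) mag (f i).
  by apply: sumr_ge0 => i _; exact: mag_ge0.
have [nN|Nn] := ltnP n N.
  rewrite (bigD1 (Ordinal nN))//= addrCA lerDl addr_ge0// addr_ge0//.
  exact: mag_ge0.
rewrite ler_wpDr//; have {hN} := hN n Nn => /ltW h.
by rewrite -[f n](subrK l) addrC; apply: le_trans (magD _ _) _; rewrite lerD2l.
Qed.

Lemma csummable_term_bounded u : csummable u ->
  exists2 K : R, 0 <= K & forall n, (0 < n)%N -> mag (u n) <= K.
Proof.
move=> /cvg_ex[l /cvgC_bounded[K K0 hK]]; exists (K + K); first exact: addr_ge0.
move=> n n0; have -> : u n = \sum_(1 <= i < n.+1) u i - \sum_(1 <= i < n) u i.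
  by rewrite big_nat_recr//= addrAC subrr add0r.
by apply: le_trans (magB _ _) _; apply: lerD.
Qed.

Lemma geometric_partial_sum (r : R) N :
  (1 - r) * \sum_(1 <= n < N.+1) r ^+ n.-1 = 1 - r ^+ N.
Proof.
elim: N => [|N IH]; first by rewrite big_geq// mulr0 expr0 subrr.
by rewrite big_nat_recr//= mulrDr IH exprS; ring.
Qed.

Lemma geometric_partial_sum_le (r : R) N : 0 <= r -> r < 1 ->
  \sum_(1 <= n < N) r ^+ n.-1 <= (1 - r)^-1.
Proof.
move=> r0 r1; have d0 : 0 < 1 - r by rewrite subr_gt0.
case: N => [|N]; first by rewrite big_geq// invr_ge0 ltW.
rewrite -(ler_pM2l d0) geometric_partial_sum divff ?gt_eqF//.
by rewrite gerBl exprn_ge0.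
Qed.

(** The terms of the Abel means of a series: [r] is sent to [1] from below. *)
Definition abel_term (r : R) u n : R[i] := r%:C ^+ n * u n.

Lemma abel_summable u r : csummable u -> 0 <= r -> r < 1 ->
  csummable (abel_term r u).
Proof.
move=> /csummable_term_bounded[K K0 uK] r0 r1.
apply: (@csummable_abs _ ((1 - r)^-1 * K)) => N.
apply: le_trans (ler_wpM2r K0 (geometric_partial_sum_le N r0 r1)).
rewrite mulr_suml; apply: ler_sum_nat => n /andP[n0 _].
rewrite magM magX mag_real ger0_norm// ler_pM ?mag_ge0 ?exprn_ge0//; last exact: uK.
by rewrite ler_wiXn2l// ?ltW// leq_pred.
Qed.

(** With [v n] the error of the [n]th partial sum, the error of the Abel mean
    is an average of the [v n] with weights [(1 - r) r^(n-1)] of total mass at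
    most [1], plus a boundary term. *)
Lemma abel_summation_by_parts u l (r : R) N :
  let v := fun n => \sum_(1 <= i < n) u i - l in
  \sum_(1 <= n < N.+1) abel_term r u n - l =
  r%:C ^+ N * v N.+1 + (1 - r%:C) * \sum_(1 <= n < N.+1) r%:C ^+ n.-1 * v n.
Proof.
move=> v; elim: N => [|N IH].
  by rewrite /v !big_geq// expr0 mulr0 addr0 mul1r.
rewrite big_nat_recr//= addrAC IH [in RHS]big_nat_recr//= /abel_term.
have -> : u N.+1 = v N.+2 - v N.+1.
  by rewrite /v [in RHS](big_nat_recr N.+1)//=; ring.
by rewrite exprS; ring.
Qed.

(** The errors [v n] are at most [e] from some rank [M] on, and the mass
    carried by the ranks below [M] is at most [(1 - r) M]. *)
Lemma abel_estimate u l : csums u l -> forall e, 0 < e ->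
  exists2 K : R, 0 <= K & forall r, 0 <= r -> r < 1 ->
    mag (csum (abel_term r u) - l) <= e + e + (1 - r) * K.
Proof.
move=> ul e e0; pose v n := \sum_(1 <= i < n) u i - l.
have [M _ hM] := (cvgC_dist _ _).1 ul e e0.
exists (\sum_(1 <= n < M) mag (v n)) => [|r r0 r1].
  by apply: sumr_ge0 => i _; exact: mag_ge0.
have d0 : 0 < 1 - r by rewrite subr_gt0.
have hs := (csumsP _).1 (abel_summable (csums_summable ul) r0 r1).
have hB : (fun N : nat => (\sum_(1 <= n < N) abel_term r u n - l : R[i]^o)) @ \oo
    --> (csum (abel_term r u) - l : R[i]^o).
  exact: (@cvgB R[i]^o R[i]^o _ _ _ _ _ _ _ hs (@cvg_cst R[i]^o l _ _ _)).
apply: (cvgC_le hB); exists M.+1 => // -[//|N] /= MN.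
rewrite abel_summation_by_parts -/(v _); rewrite -/v; apply: le_trans (magD _ _) _.
have vle n : (M <= n)%N -> mag (v n) <= e by move=> /hM/ltW.
rewrite -addrA; apply: lerD.
  rewrite magM magX mag_real ger0_norm//.
  rewrite -[leRHS]mul1r.
  apply: ler_pM; rewrite ?exprn_ge0 ?mag_ge0//; first by rewrite exprn_ile1// ltW.
  by apply: vle; rewrite ltnW.
have -> : 1 - r%:C = (1 - r)%:C :> R[i] by rewrite rmorphB.
rewrite magM mag_real ger0_norm; last exact: ltW.
(* Every error is bounded by [e], except those of rank below [M]. *)
apply: (@le_trans _ _ ((1 - r) * \sum_(1 <= n < N.+1) (r ^+ n.-1 * e +
    (if (n < M)%N then mag (v n) else 0)))).
  rewrite ler_pM2l//; apply: le_trans (mag_sum _ _ _) _.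
  apply: ler_sum_nat => n _; rewrite magM magX mag_real ger0_norm//.
  case: ltnP => nM.
    rewrite ler_wpDl// ?mulr_ge0 ?exprn_ge0 ?(ltW e0)// -[leRHS]mul1r.
    by rewrite ler_wpM2r ?mag_ge0// exprn_ile1// ltW.
  by rewrite addr0 ler_wpM2l ?exprn_ge0// vle.
rewrite big_split /= mulrDr -mulr_suml mulrA geometric_partial_sum.
apply: lerD; first by rewrite ler_piMl ?(ltW e0)// gerBl exprn_ge0.
rewrite ler_pM2l// -big_mkcond /= (@big_cat_nat _ _ _ M.+1) //=.
rewrite [X in _ + X]big_nat_cond [X in _ + X]big_pred0 ?addr0; last first.
  by move=> n; apply/negbTE; lia.
case: M MN {hM vle} => [_|M _]; first by rewrite !big_geq.
rewrite big_mkcond big_nat_recr//= ltnn addr0; apply/ler_sum_nat => n _.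
by case: ifP; rewrite ?mag_ge0.
Qed.

Theorem abel_theorem u l (r : nat -> R) : csums u l ->
  (forall k, 0 <= r k) -> (forall k, r k < 1) -> r @ \oo --> (1 : R) ->
  (fun k => csum (abel_term (r k) u) : R[i]^o) @ \oo --> (l : R[i]^o).
Proof.
move=> ul r0 r1 rlim; apply/cvgC_dist => e e0.
have e4 : 0 < e / 4 by rewrite divr_gt0.
have [K K0 hK] := abel_estimate ul e4.
have K1 : 0 < K + 1 by rewrite ltr_wpDl.
have e5 : 0 < e / 4 / (K + 1) by rewrite divr_gt0.
move/cvgrPdist_lt: rlim => /(_ _ e5) rlim.
near=> k; apply: le_lt_trans (hK _ (r0 k) (r1 k)) _.
have : 1 - r k < e / 4 / (K + 1).
  by apply: le_lt_trans (ler_norm _) _; near: k.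
rewrite ltr_pdivlMr// => h.
have : (1 - r k) * K <= (1 - r k) * (K + 1).
  by rewrite ler_wpM2l ?lerDl// subr_ge0 ltW.
move: h e0; set a := _ * (K + 1); set b := _ * K; lra.
Unshelve. all: by end_near. Qed.

End ComplexSeries.

Arguments csumsZ {R} c {u l} _.

(** * Polylogarithm coefficients against geometric sequences *)

Section PowerBounds.
Variable R : realType.
Implicit Types (z : R[i]) (r : R).

(** Multiplication by [1 - x] turns coefficients into their differences; this
    replaces differentiation of power series throughout. *)
Lemma sum_by_parts (A : comPzRingType) (a : nat -> A) (x : A) N :
  (1 - x) * \sum_(1 <= n < N.+1) a n * x ^+ n.-1 =
  a 0%N + \sum_(1 <= n < N.+1) (a n - a n.-1) * x ^+ n.-1 - a N * x ^+ N.
Proof.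
elim: N => [|N IH]; first by rewrite !big_geq// mulr0 expr0 mulr1 addr0 subrr.
by rewrite !(big_nat_recr N.+1)//= mulrDr IH !exprS; ring.
Qed.

Lemma expr_succ_diff_le d n :
  n.+1%:R ^+ d.+1 - n%:R ^+ d.+1 <= d.+1%:R * n.+1%:R ^+ d :> R.
Proof.
elim: d => [|d IH]; first by rewrite !expr1 expr0 mulr1 -natrB// subSnn.
have n0 : 0 <= n%:R :> R by [].
have h : n%:R ^+ d.+1 <= n.+1%:R ^+ d.+1 :> R.
  by rewrite lerXn2r ?nnegrE// ler_nat.
rewrite exprS [X in _ - X]exprS.
have -> : n.+1%:R * n.+1%:R ^+ d.+1 - n%:R * n%:R ^+ d.+1 =
  n.+1%:R * (n.+1%:R ^+ d.+1 - n%:R ^+ d.+1) + n%:R ^+ d.+1 :> R.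
  by rewrite -[n.+1]addn1 natrD; ring.
rewrite -[d.+2]addn1 natrD mulrDl mul1r lerD//.
have := ler_wpM2l (ler0n R n.+1) IH.
by rewrite [X in _ <= X -> _]mulrCA -exprS.
Qed.

(** By [sum_by_parts] the bound for exponent [d + 1] follows from the one for
    [d], since the differences of [n^(d+1)] are at most [(d + 1) n^d]. *)
Lemma npow_geometric_bounded d r : 0 <= r -> r < 1 ->
  exists2 B : R, 0 <= B &
    forall N, \sum_(1 <= n < N) n%:R ^+ d * r ^+ n.-1 <= B.
Proof.
move=> r0 r1; have d0 : 0 < 1 - r by rewrite subr_gt0.
elim: d => [|d [B B0 hB]].
  exists (1 - r)^-1 => [|N]; first by rewrite invr_ge0 ltW.
  under eq_bigr do rewrite expr0 mul1r.
  exact: geometric_partial_sum_le.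
exists (d.+1%:R * B / (1 - r)) => [|[|N]].
- by rewrite divr_ge0 ?(ltW d0)// mulr_ge0.
- by rewrite big_geq// divr_ge0 ?(ltW d0)// mulr_ge0.
rewrite ler_pdivlMr// mulrC (sum_by_parts (fun n => n%:R ^+ d.+1)).
rewrite expr0n /= add0r lerBlDr ler_wpDr// ?mulr_ge0 ?exprn_ge0//.
apply: le_trans (ler_wpM2l _ (hB N.+1)) => //.
rewrite mulr_sumr; apply: ler_sum_nat => -[//|n] _ /=.
by rewrite mulrA ler_wpM2r ?exprn_ge0// expr_succ_diff_le.
Qed.

(** Each term of the series with exponent [d + 1] is at most its sum, which
    gains a factor [n]. *)
Lemma npow_geometric_decay d r : 0 <= r -> r < 1 ->
  exists2 B : R, 0 <= B &
    forall n, n.+1%:R ^+ d * r ^+ n <= B / n.+1%:R.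
Proof.
move=> r0 r1; have [B B0 hB] := npow_geometric_bounded d.+1 r0 r1.
exists B => // n; rewrite ler_pdivlMr ?ltr0n// mulrC mulrA -exprS.
apply: le_trans (hB n.+2); rewrite big_nat_recr//= lerDr.
by apply: sumr_ge0 => i _; rewrite mulr_ge0// exprn_ge0.
Qed.

Definition plog_coef (q : int) (n : nat) : R := (n%:R ^ q)^-1.

(** The [n]th term of [Li_q(z) / z]; the exponent [n.-1] removes the division,
    so that [z = 0] needs no separate treatment. *)
Definition reduced_term (q : int) z n : R[i] := (plog_coef q n)%:C * z ^+ n.-1.

Lemma plog_coef_ge0 q n : 0 <= plog_coef q n.
Proof. by rewrite invr_ge0 exprz_ge0. Qed.

Lemma plog_coef_Posz m n : plog_coef (Posz m) n = (n%:R ^+ m)^-1.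
Proof. by []. Qed.

Lemma plog_coef_Negz m n : plog_coef (Negz m) n = n%:R ^+ m.+1.
Proof. exact: invrK. Qed.

Lemma plog_coef_le q n : (0 < n)%N -> plog_coef q n <= n%:R ^+ absz q.
Proof.
move=> n0; have n1 : 1 <= n%:R :> R by rewrite ler1n.
case: q => m; rewrite ?plog_coef_Negz// plog_coef_Posz.
apply: (@le_trans _ _ 1); last exact: exprn_ege1.
by rewrite invf_le1 ?exprn_ege1// exprn_gt0// ltr0n.
Qed.

Lemma plog_coef_ge q n : (0 < n)%N -> 1 <= plog_coef q n * n%:R ^+ absz q.
Proof.
move=> n0; have n1 : 1 <= n%:R :> R by rewrite ler1n.
have n2 : n%:R != 0 :> R by rewrite pnatr_eq0 -lt0n.
case: q => m; first by rewrite plog_coef_Posz mulVf// expf_neq0.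
by rewrite plog_coef_Negz -exprD exprn_ege1.
Qed.

Lemma mag_reduced_term q z n :
  mag (reduced_term q z n) = plog_coef q n * mag z ^+ n.-1.
Proof. by rewrite magM mag_real magX ger0_norm// plog_coef_ge0. Qed.

Lemma reduced_abs_bounded q r : 0 <= r -> r < 1 ->
  exists2 B : R, 0 <= B &
    forall N, \sum_(1 <= n < N) plog_coef q n * r ^+ n.-1 <= B.
Proof.
move=> r0 r1; have [B B0 hB] := npow_geometric_bounded (absz q) r0 r1.
exists B => // N; apply: le_trans (hB N); apply: ler_sum_nat => n /andP[n0 _].
by rewrite ler_wpM2r ?exprn_ge0// plog_coef_le.
Qed.

Lemma reduced_summable q z : mag z < 1 -> csummable (reduced_term q z).
Proof.
move=> z1; have [B _ hB] := reduced_abs_bounded q (mag_ge0 z) z1.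
apply: (@csummable_abs _ _ B) => N; apply: le_trans (hB N).
by under eq_bigr do rewrite mag_reduced_term.
Qed.

(** If [|z| > 1], the bounded terms [n^(-q) |z|^n] multiplied by
    [n^|q| |z|^(-n) <= B / n] would stay at least [1] while tending to [0]. *)
Lemma mag_le1_of_summable q z : csummable (reduced_term q z) -> mag z <= 1.
Proof.
move=> /csummable_term_bounded[K K0 hK]; rewrite leNgt; apply/negP => z1.
have z0 : 0 < mag z by apply: lt_trans z1.
have i0 : 0 <= (mag z)^-1 by rewrite invr_ge0 ltW.
have i1 : (mag z)^-1 < 1 by rewrite invf_lt1.
have [B B0 hB] := npow_geometric_decay (absz q) i0 i1.
have bound n : n.+1%:R <= K * B.
  have n0 : 0 < n.+1%:R :> R by rewrite ltr0n.
  suff : 1 <= K * (B / n.+1%:R) by rewrite mulrA ler_pdivlMr// mul1r.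
  have h1 := hK n.+1 isT; rewrite mag_reduced_term /= in h1.
  have h2 := plog_coef_ge q (ltn0Sn n).
  have h3 : 1 <= (plog_coef q n.+1 * mag z ^+ n) * (n.+1%:R ^+ absz q * (mag z)^-1 ^+ n).
    by rewrite mulrACA exprVn divff ?mulr1// expf_neq0// gt_eqF.
  apply: le_trans h3 _; apply: ler_pM => //.
  - by rewrite mulr_ge0 ?plog_coef_ge0// exprn_ge0 ?mag_ge0.
  - by rewrite mulr_ge0 ?exprn_ge0.
have := bound (Num.truncn (K * B)); rewrite leNgt => /negP; apply.
by rewrite truncnS_gt.
Qed.

End PowerBounds.

Arguments reduced_summable {R} q {z} _.

(** * Growth of complex polynomials *)

Section PolynomialGrowth.
Variable R : realType.
Implicit Types (G H : {poly R[i]}) (u : R[i]).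

(** Write [G = H X + c]. Either [H] is a nonzero constant, or [|u|] is
    controlled by [|H(u)|] and then: if [|H(u)| < 1] it is bounded, and
    otherwise [|u| <= |H(u) u|]. *)
Lemma poly_coercive G : (1 < size G)%N ->
  exists2 C : R, 0 <= C & forall u, mag u <= C * (1 + mag G.[u]).
Proof.
elim/poly_ind: G => [|H c IH]; first by rewrite size_poly0.
rewrite size_MXaddC; case: ifP => // _ sH.
have [sH1|sH1] := leqP (size H) 1.
  have /size_poly1P[h h0 ->] : size H == 1%N by rewrite eqn_leq sH1.
  have k0 : 0 < mag h by rewrite lt_def mag_eq0 h0 mag_ge0.
  exists ((1 + mag c) / mag h) => [|u].
    by rewrite divr_ge0 ?mag_ge0// addr_ge0// mag_ge0.
  rewrite hornerE /= !hornerE mulrAC ler_pdivlMr// mulrC -magM.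
  rewrite -{1}[h * u](addrK c); apply: le_trans (magB _ _) _.
  rewrite mulrDl mul1r mulrDr mulr1.
  have := mag_ge0 c; have := mag_ge0 (h * u + c).
  set a := mag _; set b := mag c => a0 b0.
  by have := mulr_ge0 b0 a0; lra.
have [C C0 hC] := IH sH1.
exists (C + C + 1 + mag c) => [|u].
  by rewrite !addr_ge0// mag_ge0.
rewrite !hornerE /=; have {}hC := hC u.
set a := mag (_ + c); have a0 : 0 <= a := mag_ge0 _.
have b0 := mag_ge0 c; have u0 := mag_ge0 u.
have h1 : mag H.[u] * mag u <= a + mag c.
  by rewrite -magM -{1}[H.[u] * u](addrK c); apply: magB.
have [g1|g1] := leP 1 (mag H.[u]).
  have : mag u <= mag H.[u] * mag u by rewrite ler_peMl.
  have := mulr_ge0 C0 a0; have := mulr_ge0 b0 a0; lra.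
have : C * (1 + mag H.[u]) <= C * 2 by rewrite ler_wpM2l//; lra.
have := mulr_ge0 C0 a0; have := mulr_ge0 b0 a0; lra.
Qed.

(** A polynomial grows like a power of [|u|]: at a point at most twice as
    large it is of no larger order. For [G = H X + c] the factor [X] is
    absorbed by [poly_coercive]. *)
Lemma poly_doubling G :
  exists2 C : R, 0 <= C &
    forall u v, mag v <= 2 * mag u -> mag G.[v] <= C * (1 + mag G.[u]).
Proof.
elim/poly_ind: G => [|H c [C C0 IH]].
  by exists 0 => // u v _; rewrite !horner0 mag0 mul0r.
have [sG|sG] := leqP (size (H * 'X + c%:P)) 1.
  have [d ->] : exists d, H * 'X + c%:P = d%:P.
    by exists (H * 'X + c%:P)`_0; apply: size1_polyC.
  exists 1 => // u v _; rewrite !hornerE ?mul1r.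
  by rewrite lerDr.
have [D D0 hD] := poly_coercive sG.
exists (2 * C * (D + 1 + mag c) + mag c) => [|u v uv].
  by rewrite addr_ge0 ?mulr_ge0 ?addr_ge0 ?mag_ge0.
have {}hD := hD u; move: hD; rewrite !hornerE /=.
set a := mag (H.[u] * u + c) => hD.
have a0 : 0 <= a := mag_ge0 _.
have b0 := mag_ge0 c; have u0 := mag_ge0 u.
have h1 : mag H.[u] * mag u <= a + mag c.
  by rewrite -magM -{1}[H.[u] * u](addrK c); apply: magB.
apply: le_trans (magD _ _) _; rewrite magM.
have h2 : mag H.[v] * mag v <= C * (1 + mag H.[u]) * (2 * mag u).
  by apply: ler_pM; rewrite ?mag_ge0// IH.
apply: le_trans (lerD h2 (lexx _)) _.
have -> : C * (1 + mag H.[u]) * (2 * mag u) =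
  2 * C * (mag u + mag H.[u] * mag u) by ring.
have h3 : mag u + mag H.[u] * mag u <= (D + 1 + mag c) * (1 + a).
  apply: le_trans (lerD hD h1) _.
  have := mulr_ge0 D0 a0; have := mulr_ge0 b0 a0; nra.
have h4 : 0 <= 2 * C by rewrite mulr_ge0.
have := ler_wpM2l h4 h3; have := mulr_ge0 b0 a0.
set X := mag u + _; set Y := D + 1 + mag c; nra.
Qed.

End PolynomialGrowth.

(** * Power series whose coefficients are powers of the index *)

Section PowerSeries.
Variable R : realType.
Implicit Types z : R[i].

Lemma sub1z_neq0 z : mag z < 1 -> 1 - z != 0.
Proof.
by move=> z1; rewrite subr_eq0; apply/eqP => z2; rewrite -z2 mag1 ltxx in z1.
Qed.

(** A power series in which the coefficients [n^d] are replaced by their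
    differences is [1 - z] times the original one, up to the constant term. *)
Lemma csums_of_difference d z l : mag z < 1 ->
  csums (fun n => (n%:R ^+ d - n.-1%:R ^+ d) * z ^+ n.-1) l ->
  csums (fun n => n%:R ^+ d * z ^+ n.-1) ((1 - z)^-1 * ((0%:R ^+ d) + l)).
Proof.
move=> z1 hl; have z0 := sub1z_neq0 z1.
have [B B0 hB] := npow_geometric_decay d (mag_ge0 z) z1.
have tail : (fun N => N%:R ^+ d * z ^+ N : R[i]^o) @ \oo --> (0 : R[i]^o).
  rewrite -cvg_shiftS; apply: (@cvgC_mag0 _ _ _ (fun n => B * harmonic n)).
    by rewrite -[X in _ --> X](mulr0 B); apply: cvgMr; exact: cvg_harmonic.
  apply: nearW => N /=; rewrite subr0 exprS mulrCA magM !(magM, magX).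
  rewrite -[N.+1%:R](rmorph_nat (real_complex R)) mag_real ger0_norm//.
  rewrite -[leRHS]mul1r; apply: ler_pM (hB N); rewrite ?mag_ge0 ?mulr_ge0//.
  - by rewrite exprn_ge0 ?mag_ge0.
  - exact: ltW.
rewrite /csums -cvg_shiftS /=.
have -> : (fun N => \sum_(1 <= n < N.+1) n%:R ^+ d * z ^+ n.-1) = (fun N =>
    (1 - z)^-1 * (0%:R ^+ d +
    \sum_(1 <= n < N.+1) (n%:R ^+ d - n.-1%:R ^+ d) * z ^+ n.-1
    - N%:R ^+ d * z ^+ N)).
  by apply/funext => N; rewrite -sum_by_parts mulKf.
apply: (@cvgM R[i]^o); first exact: (@cvg_cst R[i]^o).
rewrite -[X in _ --> X]subr0; apply: (@cvgB _ R[i]^o) tail.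
apply: (@cvgD _ R[i]^o); first exact: (@cvg_cst R[i]^o).
by move: hl; rewrite /csums -cvg_shiftS.
Qed.

End PowerSeries.

(** * Domination of Abel means: orders other than one *)

Section Growth.
Variable R : realType.
Implicit Types (z : R[i]) (r : R).

(** The generating function of [n^d] is the polynomial [G] evaluated at the
    inverse of [1 - z]. *)
Definition sums_powers (d : nat) (G : {poly R[i]}) := forall z, mag z < 1 ->
  csums (fun n => n%:R ^+ d * z ^+ n.-1) G.[(1 - z)^-1].

(** The differences of [n^(d+1)] are combinations of [n^0, ..., n^d] by the
    binomial theorem, so the polynomials are built by recursion: each is ['X]
    times a combination of the previous ones, in which the last has the
    nonzero coefficient [d + 1]. The family up to [d] is carried along because
    the recursion uses all of it. *)
Lemma power_sum_polynomials d : exists G : nat -> {poly R[i]},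
  forall i, (i <= d)%N -> size (G i) = i.+2 /\ sums_powers i (G i).
Proof.
elim: d => [|d [G hG]].
  exists (fun=> 'X) => -[|//] _; split=> [|z z1]; first by rewrite size_polyX.
  have := @csums_of_difference _ 0 z 0 z1.
  rewrite expr0 addr0 mulr1 hornerX; apply.
  have := csumsZ 0 ((csumsP _).1 (reduced_summable 0 z1)); rewrite mul0r.
  by apply: eq_csums => n _; rewrite mul0r !expr0 subrr mul0r.
pose c (i : nat) : R[i] := - ('C(d.+1, i)%:R * (-1) ^+ (d.+1 - i)).
pose H := \sum_(i < d.+1) c i *: G i.
have diff n : n%:R ^+ d.+1 - (n%:R - 1) ^+ d.+1 =
    \sum_(i < d.+1) c i * n%:R ^+ i :> R[i].
  rewrite addrC [n%:R - 1]addrC exprDn big_ord_recr /= subnn binn expr0 mul1r.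
  rewrite opprD mulr1n -addrA addNr addr0 -sumrN; apply: eq_bigr => i _.
  by rewrite /c mulNr -mulr_natl mulrA.
have sH : size H = d.+2.
  rewrite /H big_ord_recr /= addrC size_polyDl size_scale.
  - by have [-> _] := hG d (leqnn d).
  - by rewrite /c oppr_eq0 mulf_neq0 ?signr_eq0// pnatr_eq0 -lt0n bin_gt0.
  - have [-> _] := hG d (leqnn d).
    rewrite ltnS; apply: leq_trans (size_sum _ _ _) _.
    apply/bigmax_leqP => i _; apply: leq_trans (size_scale_leq _ _) _.
    by have [-> _] := hG i (ltnW (ltn_ord i)); rewrite ltnS ltn_ord.
  - by rewrite /c oppr_eq0 mulf_neq0 ?signr_eq0// pnatr_eq0 -lt0n bin_gt0.
exists (fun i => if (i <= d)%N then G i else 'X * H) => i id.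
case: leqP => [id'|di]; first exact: hG.
have -> : i = d.+1 by apply/eqP; rewrite eqn_leq id di.
split.
  by rewrite mulrC size_mulX ?sH// -size_poly_gt0 sH.
move=> z z1; rewrite hornerM hornerX.
rewrite -[X in _ * X]add0r; have {1}-> : 0 = 0%:R ^+ d.+1 :> R[i].
  by rewrite expr0n.
apply: csums_of_difference => //.
have : csums (fun n => \sum_(i < d.+1) c i * (n%:R ^+ i * z ^+ n.-1))
    (\sum_(i < d.+1) c i * (G i).[(1 - z)^-1]).
  apply: csums_sum => j; apply: csumsZ.
  by have [_] := hG j (leq_ord j); apply.
have -> : \sum_(i < d.+1) c i * (G i).[(1 - z)^-1] = H.[(1 - z)^-1].
  by rewrite /H horner_sum; apply: eq_bigr => j _; rewrite hornerZ.
apply: eq_csums => -[//|n] _ /=.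
under eq_bigr do rewrite mulrA.
by rewrite -mulr_suml -diff; congr ((_ - _ ^+ _) * _); rewrite -[n.+1]addn1 natrD addrK.
Qed.

(** [|1 - z| <= |1 - r z| + (1 - r)], and [1 - r <= 1 - r |z| <= |1 - r z|]. *)
Lemma mag_sub1_le z r : mag z < 1 -> 0 <= r -> r < 1 ->
  mag (1 - z) <= 2 * mag (1 - r%:C * z).
Proof.
move=> z1 r0 r1.
have -> : 1 - z = (1 - r%:C * z) - (1 - r%:C) * z by ring.
apply: le_trans (magB _ _) _; rewrite mulr_natl mulr2n lerD2l magM.
have -> : 1 - r%:C = (1 - r)%:C :> R[i] by rewrite rmorphB.
rewrite mag_real ger0_norm ?subr_ge0 ?(ltW r1)//.
have h : 1 - r * mag z <= mag (1 - r%:C * z).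
  rewrite lerBlDr; have -> : r * mag z = mag (r%:C * z).
    by rewrite magM mag_real ger0_norm.
  by rewrite -{1}(mag1 R) -{1}[1](subrK (r%:C * z)); exact: magD.
apply: le_trans h; have := mag_ge0 z; nra.
Qed.

(** The Abel means of the series [Li_q(z) / z] are bounded by its sum, uniformly
    in the open unit disc. This is what makes the passage to the limit under
    the integral possible: up to constants, an integrable sum dominates its
    own Abel means, even where it blows up at the unit circle. *)
Definition abel_dominated (q : int) := exists2 C : R, 0 <= C &
  forall z r, mag z < 1 -> 0 <= r -> r < 1 ->
    mag (csum (abel_term r (reduced_term q z))) <=
    C * (1 + mag (csum (reduced_term q z))).

Lemma abel_term_reduced q z r n : (0 < n)%N ->
  abel_term r (reduced_term q z) n = r%:C * reduced_term q (r%:C * z) n.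
Proof.
case: n => // n _; rewrite /abel_term /reduced_term /= exprMn exprS; ring.
Qed.

Lemma mag_scale_lt1 z r : mag z < 1 -> 0 <= r -> r < 1 -> mag (r%:C * z) < 1.
Proof.
move=> z1 r0 r1; rewrite magM mag_real ger0_norm//.
by apply: le_lt_trans z1; rewrite ler_piMl ?mag_ge0// ltW.
Qed.

(** For [q = -d] the sum is a polynomial in [u = (1 - z)^-1], and replacing [z]
    by [r z] at most doubles [|u|]. *)
Lemma abel_dominated_nonpos d (q : int) :
  (forall n, (0 < n)%N -> plog_coef R q n = n%:R ^+ d) -> abel_dominated q.
Proof.
move=> hq; have [Gs hG] := power_sum_polynomials d.
have {hG} [sG hG] := hG d (leqnn d).
set G := Gs d in sG hG.
have sumE z : mag z < 1 -> csum (reduced_term q z) = G.[(1 - z)^-1].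
  move=> z1; apply: csums_csum; apply: eq_csums (hG z z1) => n n0.
  by rewrite /reduced_term hq// rmorphXn /= rmorph_nat.
have [C C0 hC] := poly_doubling G; exists C => // z r z1 r0 r1.
have rz1 := mag_scale_lt1 z1 r0 r1.
have -> : csum (abel_term r (reduced_term q z)) = r%:C * G.[(1 - r%:C * z)^-1].
  rewrite -sumE//; apply: csums_csum.
  have := csumsZ r%:C ((csumsP _).1 (reduced_summable q rz1)).
  by apply: eq_csums => n n0; rewrite abel_term_reduced.
rewrite sumE// magM mag_real ger0_norm//.
have h (y : R[i]) : mag y < 1 -> 0 < mag (1 - y).
  by move=> y1; rewrite lt_def mag_eq0 sub1z_neq0// mag_ge0.
have uv : mag (1 - r%:C * z)^-1 <= 2 * mag (1 - z)^-1.
  rewrite !magV ler_pdivlMr ?h// mulrC ler_pdivrMr ?h//.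
  exact: mag_sub1_le.
by apply: le_trans (hC _ _ uv); rewrite ler_piMl ?mag_ge0// ltW.
Qed.

Lemma sum_inv_square_le (N : nat) : \sum_(1 <= n < N) (n%:R ^+ 2)^-1 <= 2 :> R.
Proof.
case: N => [|[|N]]; [by rewrite big_geq|by rewrite big_geq|].
suff : \sum_(1 <= n < N.+2) (n%:R ^+ 2)^-1 <= 2 - N.+1%:R^-1 :> R.
  by move=> h; apply: le_trans h _; rewrite gerBl invr_ge0.
elim: N => [|N IH]; first by rewrite big_nat1 expr1n !invr1 (_ : 2 - 1 = 1)//; ring.
rewrite big_nat_recr//=; apply: le_trans (lerD IH (lexx _)) _.
have a0 : 0 < N.+1%:R :> R by rewrite ltr0n.
have -> : N.+2%:R = N.+1%:R + 1 :> R by rewrite -[N.+2]addn1 natrD.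
move: N.+1%:R a0 => a a0.
have a1 : 0 < a + 1 by lra.
rewrite -subr_ge0; suff -> : 2 - (a + 1)^-1 - (2 - a^-1 + ((a + 1) ^+ 2)^-1) =
  (a * (a + 1) ^+ 2)^-1 by rewrite invr_ge0 mulr_ge0 ?sqr_ge0// ltW.
field; lra.
Qed.

Lemma mag_abel_term r u n : 0 <= r -> mag (abel_term r u n) = r ^+ n * mag (u n) :> R.
Proof. by move=> r0; rewrite magM magX mag_real ger0_norm. Qed.

Lemma abel_dominated_ge2 q : (2 <= q)%R -> abel_dominated q.
Proof.
move=> q2; exists 2 => // z r z1 r0 r1.
have hs := (csumsP _).1 (abel_summable (reduced_summable q z1) r0 r1).
apply: (@le_trans _ _ 2); last first.
  by rewrite -[leLHS]mulr1 ler_wpM2l// lerDl mag_ge0.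
apply: csums_le hs _ => N; apply: le_trans (sum_inv_square_le N).
apply: le_trans (mag_sum _ _ _) _; apply: ler_sum_nat => n /andP[n0 _].
rewrite mag_abel_term// mag_reduced_term.
have n1 : 1 <= n%:R :> R by rewrite ler1n.
have : plog_coef R q n <= (n%:R ^+ 2)^-1.
  case: q q2 => // m m2; rewrite plog_coef_Posz lef_pV2 ?posrE ?exprn_gt0 ?ltr0n//.
  by rewrite ler_weXn2l//; lia.
have := plog_coef_ge0 R q n; set a := plog_coef R q n => a0 h.
apply: le_trans h; rewrite mulrCA; apply: ler_piMr => //.
rewrite -[leRHS]mul1r; apply: ler_pM; rewrite ?exprn_ge0 ?mag_ge0//.
- by rewrite exprn_ile1 ?(ltW r1).
- by rewrite exprn_ile1 ?mag_ge0 ?(ltW z1).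
Qed.

End Growth.

(** * Domination of Abel means: order one, and all orders together *)

Section OrderOne.
Variable R : realType.
Implicit Types (z : R[i]) (r : R).

(** The differences of a nonincreasing nonnegative sequence telescope, so
    [sum_by_parts] bounds the series by [2 c_0 / |1 - z|]. *)
Lemma nonincreasing_series_bound (c : nat -> R) z N :
  (forall n, 0 <= c n) -> (forall n, c n.+1 <= c n) -> mag z <= 1 ->
  mag ((1 - z) * \sum_(1 <= n < N) (c n.-1)%:C * z ^+ n.-1) <= 2 * c 0%N.
Proof.
move=> c0 c1 z1; case: N => [|N].
  by rewrite big_geq// mulr0 mag0 mulr_ge0.
rewrite (sum_by_parts (fun n => (c n.-1)%:C)) /=.
apply: le_trans (magB _ _) _; apply: (@le_trans _ _
    (c 0%N + \sum_(1 <= n < N.+1) (c n.-1.-1 - c n.-1) + c N.-1)).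
  apply: lerD; last first.
    rewrite magM magX mag_real ger0_norm// ler_piMr//.
    by rewrite exprn_ile1 ?mag_ge0.
  apply: le_trans (magD _ _) _; apply: lerD; first by rewrite mag_real ger0_norm.
  apply: le_trans (mag_sum _ _ _) _; apply: ler_sum => n _.
  rewrite -rmorphB magM magX mag_real distrC ger0_norm ?subr_ge0; last first.
    by case: n => [|[|n]] /=.
  rewrite ler_piMr ?exprn_ile1 ?mag_ge0// subr_ge0.
  by case: n => [|[|n]] /=.
have -> : \sum_(1 <= n < N.+1) (c n.-1.-1 - c n.-1) = c 0%N - c N.-1.
  elim: N => [|N IH]; first by rewrite big_geq// subrr.
  by rewrite big_nat_recr//= IH addrA subrK.
by rewrite addrA subrK mulr_natl mulr2n.
Qed.

Lemma one_sub_expr_ge r m : 0 <= r -> r < 1 ->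
  m%:R * r ^+ m * (1 - r) <= 1 - r ^+ m.
Proof.
move=> r0 r1; elim: m => [|m IH]; first by rewrite !mul0r expr0 subrr.
have -> : 1 - r ^+ m.+1 = (1 - r ^+ m) + r ^+ m * (1 - r) by rewrite exprS; ring.
apply: (@le_trans _ _ (m.+1%:R * r ^+ m * (1 - r))).
  rewrite ler_wpM2r ?subr_ge0 ?(ltW r1)// ler_wpM2l// exprS ler_piMl ?exprn_ge0//.
  exact: ltW.
by rewrite -[m.+1]addn1 natrD mulrDl mul1r mulrDl lerD2r.
Qed.

(** [(1 - r^n) / n] is [1 - r] times the average of [r^0, ..., r^(n-1)]. *)
Lemma abel_gap_coef_nonincreasing r n : 0 <= r -> r < 1 ->
  (1 - r ^+ n.+2) / n.+2%:R <= (1 - r ^+ n.+1) / n.+1%:R :> R.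
Proof.
move=> r0 r1; rewrite ler_pdivrMr ?ltr0n// mulrAC ler_pdivlMr ?ltr0n//.
have := one_sub_expr_ge n.+1 r0 r1.
rewrite [r ^+ n.+2]exprS -[n.+2]addn1 natrD.
set a := n.+1%:R; set b := r ^+ n.+1; nra.
Qed.

Local Notation u := (reduced_term 1).

Lemma reduced_term1E z n : u z n = (n%:R^-1)%:C * z ^+ n.-1.
Proof. by []. Qed.

(** The difference has the nonincreasing coefficients [(1 - r^n) / n]. *)
Lemma order1_gap z r : mag z < 1 -> 0 <= r -> r < 1 ->
  mag (csum (u z) - csum (abel_term r (u z))) <= 2 * (1 - r) / mag (1 - z).
Proof.
move=> z1 r0 r1; have hz := (csumsP _).1 (reduced_summable 1 z1).
have hr := (csumsP _).1 (abel_summable (reduced_summable 1 z1) r0 r1).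
have k0 : 0 < mag (1 - z) by rewrite lt_def mag_eq0 sub1z_neq0// mag_ge0.
rewrite ler_pdivlMr// mulrC -magM.
apply: csums_le (csumsZ (1 - z) (csumsB hz hr)) _ => N.
pose c n : R := (1 - r ^+ n.+1) / n.+1%:R.
have c0 n : 0 <= c n by rewrite divr_ge0// subr_ge0 exprn_ile1// ltW.
have := @nonincreasing_series_bound c z N c0
  (fun n => abel_gap_coef_nonincreasing n r0 r1) (ltW z1).
rewrite {2}/c expr1 divr1 mulr_sumr; congr (mag _ <= _).
apply: eq_big_nat => -[//|n] _ /=.
rewrite /abel_term reduced_term1E /c /= rmorphM rmorphB rmorph1 rmorphXn /=; ring.
Qed.

Lemma mag_sub1X_le z n : mag z <= 1 -> mag (1 - z ^+ n) <= n%:R * mag (1 - z).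
Proof.
move=> z1; elim: n => [|n IH]; first by rewrite expr0 subrr mag0 mul0r.
have -> : 1 - z ^+ n.+1 = (1 - z ^+ n) + z ^+ n * (1 - z) by rewrite exprS; ring.
apply: le_trans (magD _ _) _; rewrite -[n.+1]addn1 natrD mulrDl mul1r lerD//.
by rewrite magM magX ler_piMl ?mag_ge0// exprn_ile1 ?mag_ge0.
Qed.

(** Put [rho = 1 - |1 - z| >= r]. The Abel mean at [r] is at most
    [sum r^n / n <= sum rho^n / n], and the latter series differs from the Abel
    mean at [rho] by at most [|1 - z| sum rho^(n-1) = 1], because
    [|1 - z^(n-1)| <= (n - 1) |1 - z|]. *)
Lemma order1_monotone z r : mag z < 1 -> 0 <= r -> mag (1 - z) <= 1 - r ->
  mag (csum (abel_term r (u z))) <=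
  mag (csum (abel_term (1 - mag (1 - z)) (u z))) + 1.
Proof.
move=> z1 r0 rz; set rho := 1 - mag (1 - z).
have k0 : 0 < mag (1 - z) by rewrite lt_def mag_eq0 sub1z_neq0// mag_ge0.
have r1 : r < 1 by lra.
have rr : r <= rho by rewrite /rho; lra.
have rho0 : 0 <= rho by apply: le_trans rr.
have rho1 : rho < 1 by rewrite /rho; lra.
have hr := (csumsP _).1 (abel_summable (reduced_summable 1 z1) r0 r1).
have hrho := (csumsP _).1 (abel_summable (reduced_summable 1 z1) rho0 rho1).
apply/ler_addgt0Pr => e e0.
apply: (cvgC_le hr); have := (cvgC_dist _ _).1 hrho e e0.
apply: filterS => N hN.
have h1 : mag (\sum_(1 <= n < N) abel_term r (u z) n) <=
    \sum_(1 <= n < N) rho ^+ n / n%:R.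
  apply: le_trans (mag_sum _ _ _) _; apply: ler_sum => n _.
  rewrite mag_abel_term// reduced_term1E magM mag_real magX ger0_norm ?invr_ge0//.
  apply: ler_pM; rewrite ?exprn_ge0 ?mulr_ge0 ?mag_ge0 ?invr_ge0//.
  - by rewrite exprn_ge0// mag_ge0.
  - by rewrite lerXn2r ?nnegrE.
  - by rewrite ler_piMr ?invr_ge0// exprn_ile1 ?mag_ge0// ltW.
have h2 : \sum_(1 <= n < N) rho ^+ n / n%:R <=
    mag (\sum_(1 <= n < N) abel_term rho (u z) n) + 1.
  have -> : \sum_(1 <= n < N) rho ^+ n / n%:R =
      mag (\sum_(1 <= n < N) (rho ^+ n / n%:R)%:C).
    rewrite -rmorph_sum mag_real ger0_norm// sumr_ge0// => n _.
    by rewrite divr_ge0// exprn_ge0.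
  rewrite -[X in mag X <= _](subrK (\sum_(1 <= n < N) abel_term rho (u z) n)).
  apply: le_trans (magD _ _) _; rewrite [leLHS]addrC lerD2l -sumrB.
  apply: le_trans (mag_sum _ _ _) _.
  apply: (@le_trans _ _ (\sum_(1 <= n < N) mag (1 - z) * rho ^+ n.-1)).
    apply: ler_sum_nat => n /andP[n0 _].
    have -> : (rho ^+ n / n%:R)%:C - abel_term rho (u z) n =
      (rho ^+ n / n%:R)%:C * (1 - z ^+ n.-1).
      by rewrite /abel_term reduced_term1E rmorphM rmorphXn /=; ring.
    rewrite magM mag_real ger0_norm ?divr_ge0 ?exprn_ge0//.
    apply: le_trans (ler_wpM2l _ (mag_sub1X_le n.-1 (ltW z1))) _.
      by rewrite divr_ge0 ?exprn_ge0.
    rewrite mulrA mulrC ler_pM2l//.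
    case: n n0 => // n _ /=; rewrite -mulrA exprS mulrAC ler_piMl ?exprn_ge0//.
    have : n.+1%:R^-1 * n%:R <= 1 :> R by rewrite ler_pdivrMl ?ltr0n// mulr1 ler_nat.
    have : 0 <= n.+1%:R^-1 * n%:R :> R by rewrite mulr_ge0 ?invr_ge0.
    by move=> a0 a1; rewrite -[leRHS]mulr1 ler_pM// ltW.
  rewrite -mulr_sumr; apply: le_trans (ler_wpM2l (mag_ge0 _)
    (geometric_partial_sum_le N rho0 rho1)) _.
  by rewrite /rho opprB addrCA subrr addr0 divff// gt_eqF.
apply: le_trans h1 _; apply: le_trans h2 _; rewrite addrAC lerD2r.
rewrite -[X in mag X <= _](subrK (csum (abel_term rho (u z)))).
by apply: le_trans (magD _ _) _; rewrite [leLHS]addrC lerD2l ltW.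
Qed.

(** For [z] near [1] the sum is of the size of [- ln |1 - z|], and the Abel mean
    of that of [- ln |1 - r z|], which is no larger up to a constant. If
    [1 - r <= |1 - z|], then [order1_gap] bounds the difference by [2].
    Otherwise [r] is increased first to [1 - |1 - z|]. *)
Lemma abel_dominated_1 : abel_dominated R 1.
Proof.
exists 3 => // z r z1 r0 r1.
have k0 : 0 < mag (1 - z) by rewrite lt_def mag_eq0 sub1z_neq0// mag_ge0.
have s0 := mag_ge0 (csum (u z)).
have close (r' : R) : 0 <= r' -> r' < 1 -> 1 - r' <= mag (1 - z) ->
    mag (csum (abel_term r' (u z))) <= mag (csum (u z)) + 2.
  move=> r0' r1' h; have := order1_gap z1 r0' r1' => g.
  rewrite -[X in mag X](subKr (csum (u z))).
  apply: le_trans (magB _ _) _; rewrite lerD2l; apply: le_trans g _.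
  by rewrite ler_pdivrMr// ler_wpM2l.
have [h|/ltW h] := leP (1 - r) (mag (1 - z)).
  by apply: le_trans (close _ r0 r1 h) _; lra.
apply: le_trans (order1_monotone z1 r0 h) _.
have := close (1 - mag (1 - z)); rewrite subKr => /(_ _ _ (lexx _)) g.
have : 0 <= 1 - mag (1 - z) by lra.
have : 1 - mag (1 - z) < 1 by lra.
by move=> a b; have := g b a; lra.
Qed.

Theorem polylog_abel_dominated q : abel_dominated R q.
Proof.
case: q => [[|[|n]]|n].
- by apply: (@abel_dominated_nonpos _ 0) => m _; rewrite plog_coef_Posz !expr0 invr1.
- exact: abel_dominated_1.
- exact: abel_dominated_ge2.
- by apply: (@abel_dominated_nonpos _ n.+1) => m _; rewrite plog_coef_Negz.
Qed.

End OrderOne.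

(** * The factorial integral and the moments of the logarithm *)

Section LogMoments.
Variable R : realType.
Implicit Types (Q : {poly R}) (k : R).
Local Notation mu := (@lebesgue_measure R).
Local Notation I01 := `](0 : R), (1 : R)[%classic.

(** Such a [Q] gives [- exp (- k u) Q(u)] as an antiderivative of
    [exp (- k u) u^s], and, through [t = exp (- u)], [t^k Q(- ln t)] as one of
    [(- ln t)^s t^(k-1)]. *)
Lemma log_primitive_poly (s : nat) k : k != 0 ->
  exists Q, k *: Q - Q^`() = 'X^s /\ Q.[0] = s`!%:R / k ^+ s.+1.
Proof.
move=> k0; elim: s => [|s [Q [hQ Q0]]].
  exists (k^-1)%:P; rewrite derivC subr0 hornerC expr1 mul1r expr0.
  by split => //; rewrite -mul_polyC -polyCM mulfV.
exists (k^-1 *: ('X^(s.+1) + s.+1%:R *: Q)); split.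
  rewrite derivZ derivD derivXn derivZ scalerA mulfV// scale1r.
  have -> : 'X^(s.+1.-1) *+ s.+1 = s.+1%:R *: (k *: Q - Q^`()).
    by rewrite hQ scaler_nat.
  rewrite /= -scalerDr subrK [_ *: (k *: Q)]scalerA.
  by rewrite scalerA [_ * k]mulrC mulrA mulVf// mul1r addrK.
rewrite !hornerE Q0 expr0n /= add0r factS natrM [k ^+ s.+2]exprS.
by field; rewrite expf_neq0 k0.
Qed.

(** One factor ['X] costs half of the exponent: [u <= (2 / k) exp (k u / 2)]. *)
Lemma poly_le_exp Q k : 0 < k ->
  exists2 B : R, 0 <= B & forall u, 0 <= u -> `|Q.[u]| <= B * expR (k * u).
Proof.
elim/poly_ind: Q k => [|Q c IH] k k0.
  by exists 0 => // u _; rewrite horner0 normr0 mul0r.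
have k2 : 0 < k / 2 by rewrite divr_gt0.
have [B B0 hB] := IH _ k2.
exists (B * (2 / k) + `|c|) => [|u u0].
  by rewrite addr_ge0// mulr_ge0// divr_ge0// ltW.
rewrite hornerMXaddC; apply: le_trans (ler_normD _ _) _; rewrite mulrDl; apply: lerD.
  have -> : k * u = k / 2 * u + k / 2 * u by field.
  rewrite expRD normrM (ger0_norm u0) mulrACA; apply: ler_pM => //; first exact: hB.
  rewrite -ler_pdivrMl ?divr_gt0// invf_div.
  by apply: le_trans (expR_ge1Dx _); rewrite lerDr.
by rewrite ler_peMr// (le_trans _ (expR_ge1Dx _))// lerDl mulr_ge0// ltW.
Qed.

Lemma poly_exp_cvg0 Q k : 0 < k ->
  (expR (- (k * u)) * Q.[u]) @[u --> +oo] --> (0 : R).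
Proof.
move=> k0; have [B B0 hB] := poly_le_exp (Q * 'X) k0.
apply/cvgrPdist_le => e e0; near=> u.
have u0 : 0 < u by near: u; apply: nbhs_pinfty_gt; exact: num_real.
have ue : B / e <= u by near: u; apply: nbhs_pinfty_ge; exact: num_real.
rewrite sub0r normrN normrM ger0_norm ?expR_ge0// expRN mulrC.
rewrite ler_pdivrMr ?expR_gt0//.
have := hB u (ltW u0); rewrite hornerE hornerX normrM (gtr0_norm u0) => h.
rewrite -(ler_pM2r u0); apply: le_trans h _.
rewrite mulrAC ler_pM2r ?expR_gt0// mulrC.
by rewrite -ler_pdivrMr.
Unshelve. all: by end_near. Qed.

Lemma is_derive_exp_poly Q k (u : R) :
  is_derive u 1 (fun u => - (expR (- (k * u)) * Q.[u]))
    (expR (- (k * u)) * (k *: Q - Q^`()).[u]).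
Proof.
have dk : is_derive u (1 : R) (fun u => - (k * u)) (- k).
  have := is_deriveN (@is_deriveZ R R^o R^o id k u 1 1 (is_derive_id _ _)).
  by rewrite /GRing.scale /= mulr1.
have dE := @is_derive1_comp _ expR _ u _ _ (is_derive_expR _) dk.
have := is_deriveN (is_deriveM dE (is_derive_poly Q u)).
move/trigger_derive; apply.
by rewrite !hornerE /GRing.scale /=; ring.
Qed.

Lemma exp_moment (s : nat) :
  (\int[mu]_(u in `[0%R, +oo[) (expR (- u) * u ^+ s)%:E = (s`!%:R)%:E)%E.
Proof.
have [Q [hQ Q0]] := @log_primitive_poly s 1 (oner_neq0 _).
pose F (u : R) := - (expR (- (1 * u)) * Q.[u]).
have dF (u : R) : is_derive u 1 F (expR (- u) * u ^+ s).
  by apply: trigger_derive (is_derive_exp_poly Q 1 u) _; rewrite hQ hornerXn mul1r.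
have cF u : {for u, continuous F}.
  by apply/differentiable_continuous/derivable1_diffP; have [] := dF u.
have F0 : F 0 = - s`!%:R.
  by rewrite /F mulr0 oppr0 expR0 mul1r Q0 expr1n divr1.
rewrite (@ge0_continuous_FTC2y _ _ F 0 0).
- by rewrite F0 EFinN oppeK add0e.
- by move=> u u0; rewrite mulr_ge0 ?expR_ge0// exprn_ge0.
- apply: continuous_subspaceT => u; apply: cvgM.
    apply: continuous_comp; first exact: opp_continuous.
    exact: continuous_expR.
  exact: exprn_continuous.
- rewrite -[X in _ --> X]oppr0; apply: cvgN.
  exact: (poly_exp_cvg0 Q ltr01).
- by move=> u _; have [] := dF u.
- by apply: cvg_at_right_filter; exact: cF.
- by move=> u _; rewrite derive1E; have [_ ->] := dF u.
Qed.

Theorem Gamma_nat (s : nat) : Gamma (s%:R + 1) = s`!%:R :> R.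
Proof.
rewrite /Gamma /Rintegral.
rewrite (_ : s`!%:R = fine (s`!%:R%:E : \bar R))//; congr fine.
rewrite -exp_moment -integral_itv_obnd_cbnd; last first.
  apply/measurable_EFinP; apply: measurable_funM.
    by apply: measurable_funTS; apply: measurableT_comp => //; exact: measurable_expR.
  exact: measurable_funX.
apply: eq_integral => t; rewrite inE /= in_itv /= andbT => t0.
by rewrite addrK powR_mulrn ?(ltW t0)// mulrC.
Qed.

(** The integral on [[exp (- n), 1]] is given by the fundamental theorem of
    calculus; the interval then increases to [(0, 1]]. *)
Lemma log_moment_ereal (s j : nat) :
  (\int[mu]_(t in I01) ((- ln t) ^+ s * t ^+ j)%:E =
   (s`!%:R / j.+1%:R ^+ s.+1)%:E)%E.
Proof.
pose k : R := j.+1%:R; have k0 : 0 < k by rewrite ltr0n.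
have [Q [hQ Q0]] := @log_primitive_poly s k (lt0r_neq0 k0).
pose f (t : R) := (- ln t) ^+ s * t ^+ j.
pose F (t : R) := t ^+ j.+1 * Q.[- ln t].
have dF (t : R) : 0 < t -> is_derive t 1 F (f t).
  move=> t0; have d1 := is_deriveN (is_derive1_ln t0).
  have d2 := @is_derive1_comp _ (horner Q) _ t _ _ (is_derive_poly Q _) d1.
  have := is_deriveM (is_deriveX j.+1 (is_derive_id t (1 : R))) d2.
  have -> : id ^+ j.+1 * (horner Q \o - @ln R) = F.
    by apply/funext => y; rewrite /F !fctE.
  move/trigger_derive; apply; rewrite fctE /=.
  have hs : (- ln t) ^+ s = (k *: Q - Q^`()).[- ln t] by rewrite hQ hornerXn.
  rewrite /f hs !hornerE /GRing.scale /= !exprS.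
  by field; rewrite gt_eqF.
have cF t : 0 < t -> {for t, continuous F}.
  move=> /dF[+ _]; move/derivable1_diffP; exact: differentiable_continuous.
have cf t : 0 < t -> {for t, continuous f}.
  move=> t0; apply: cvgM; last exact: exprn_continuous.
  apply: (@continuous_comp _ _ _ (fun t => - ln t) (fun y => y ^+ s)).
    by apply: cvgN; exact: continuous_ln.
  exact: exprn_continuous.
have F1 : F 1 = s`!%:R / j.+1%:R ^+ s.+1.
  by rewrite /F expr1n mul1r ln1 oppr0 Q0.
pose A (n : nat) : set R := `[expR (- n.+1%:R), 1]%classic.
have intA n : (\int[mu]_(t in A n) (f t)%:E =
    (F 1)%:E - (F (expR (- n.+1%:R)))%:E)%E.
  apply: continuous_FTC2.
  - by rewrite -expR0 ltr_expR oppr_lt0.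
  - apply: continuous_in_subspaceT => t; rewrite inE /= in_itv /= => /andP[t0 _].
    by apply: cf; apply: lt_le_trans t0; exact: expR_gt0.
  - split.
    + move=> t; rewrite in_itv /= => /andP[t0 _].
      by have [] := dF t (lt_trans (expR_gt0 _) t0).
    + by apply: cvg_at_right_filter; apply: cF; exact: expR_gt0.
    + by apply: cvg_at_left_filter; exact: cF.
  - move=> t; rewrite in_itv /= => /andP[t0 _].
    by rewrite derive1E; have [_ ->] := dF t (lt_trans (expR_gt0 _) t0).
have mf : measurable_fun setT (EFin \o f).
  apply/measurable_EFinP; apply: measurable_funM; apply: measurable_funX => //.
  by apply: measurableT_comp => //; exact: measurable_ln.
have UA : \bigcup_n A n = `]0%R, 1%R]%classic.
  apply/seteqP; split=> [t [n _]|t]; rewrite /A /= !in_itv /=.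
    by move=> /andP[t0 ->]; rewrite (lt_le_trans (expR_gt0 _) t0).
  move=> /andP[t0 t1]; exists (Num.truncn (- ln t)) => //=.
  rewrite in_itv /= t1 andbT -[leRHS](lnK t0) ler_expR lerNl.
  by rewrite ltW// truncnS_gt.
transitivity (\int[mu]_(t in `]0%R, 1%R]) (f t)%:E)%E.
  by rewrite -integral_itv_bndo_bndc//; exact: measurable_funTS.
rewrite -UA; apply: (@cvg_unique _ (@ereal_hausdorff R) _ _ _ _
  (ge0_nondecreasing_set_cvg_integral _ _ _ _)) => /=.
- apply/nondecreasing_seqP => n; rewrite subsetEset /A => t /=.
  rewrite !in_itv /= => /andP[t0 ->]; rewrite andbT; apply: le_trans t0.
  by rewrite ler_expR lerN2 ler_nat.
- by move=> n; exact: measurable_itv.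
- by move=> n; exact: measurable_funTS.
- move=> n t; rewrite /A /= in_itv /= => /andP[t0 t1].
  have t2 : 0 < t by apply: lt_le_trans t0; exact: expR_gt0.
  rewrite lee_fin mulr_ge0 ?exprn_ge0 ?(ltW t2)// oppr_ge0.
  by rewrite -ln1 ler_ln ?posrE.
under eq_fun do rewrite intA -EFinB.
apply/fine_cvgP; split; first exact: nearW.
rewrite -F1 -[X in _ --> X]subr0; apply: cvgB; first exact: cvg_cst.
have h := poly_exp_cvg0 Q k0.
have h2 : (fun n : nat => n.+1%:R : R) @ \oo --> +oo.
  by rewrite (cvg_shiftS (fun n : nat => n%:R : R)); exact: cvgr_idn.
apply: cvg_trans (cvg_comp _ _ h2 h); apply: near_eq_cvg; apply: nearW => n /=.
by rewrite /F expRK opprK -expRM_natl mulrN.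
Qed.

Lemma neg_log_moment_integrable (s j : nat) :
  mu.-integrable I01 (EFin \o (fun t => (- ln t) ^+ s * t ^+ j)).
Proof.
apply/integrableP; split.
  apply/measurable_EFinP; apply: measurable_funTS.
  apply: measurable_funM; apply: measurable_funX => //.
  by apply: measurableT_comp => //; exact: measurable_ln.
rewrite (_ : integral _ _ _ = (s`!%:R / j.+1%:R ^+ s.+1)%:E) ?ltry//.
rewrite -log_moment_ereal; apply: eq_integral => t; rewrite inE /= in_itv /=.
move=> /andP[t0 t1]; congr EFin; rewrite ger0_norm// mulr_ge0 ?exprn_ge0//.
  by rewrite oppr_ge0 -ln1 ler_ln ?posrE// ltW.
exact: ltW.
Qed.

Lemma log_moment_integrable (s j : nat) :
  mu.-integrable I01 (EFin \o (fun t => ln t ^+ s * t ^+ j)).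
Proof.
apply: le_integrable (neg_log_moment_integrable s j) => //.
  apply/measurable_EFinP; apply: measurable_funTS.
  by apply: measurable_funM; apply: measurable_funX.
by move=> t _; rewrite lee_fin !normrM !normrX normrN.
Qed.

Theorem log_moment (s j : nat) :
  \int[mu]_(t in I01) (ln t ^+ s * t ^+ j) =
  (-1) ^+ s * (s`!%:R / j.+1%:R ^+ s.+1).
Proof.
have -> : s`!%:R / j.+1%:R ^+ s.+1 =
    \int[mu]_(t in I01) ((- ln t) ^+ s * t ^+ j).
  by rewrite /Rintegral log_moment_ereal.
rewrite -RintegralZl//; last exact: neg_log_moment_integrable.
by apply: eq_Rintegral => t _; rewrite mulrA -exprMn mulN1r opprK.
Qed.

End LogMoments.

(** * Complex integrals on the open unit interval *)

Section ComplexIntegral.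
Variable R : realType.
Implicit Types (f g : R -> R[i]).
Local Notation mu := (@lebesgue_measure R).
Local Notation I01 := `](0 : R), (1 : R)[%classic.

(** The endpoints are left out: there the logarithm and the polylogarithm may
    only have conventional values. *)
Definition cintegrable_oo f :=
  mu.-integrable I01 (EFin \o (fun t => complex.Re (f t))) /\
  mu.-integrable I01 (EFin \o (fun t => complex.Im (f t))).

Definition cintegral_oo f : R[i] :=
  (\int[mu]_(t in I01) complex.Re (f t)) +i*
  (\int[mu]_(t in I01) complex.Im (f t)).

Lemma cintegral01_open f : cintegrable01 f ->
  cintegrable_oo f /\ cintegral01 f = cintegral_oo f.
Proof.
have sub : I01 `<=` `[0, 1]%classic.
  by move=> t /=; rewrite !in_itv /= => /andP[/ltW -> /ltW ->].
move=> [hr hi].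
have ir : mu.-integrable I01 (EFin \o (fun t => complex.Re (f t))).
  exact: integrableS hr.
have ii : mu.-integrable I01 (EFin \o (fun t => complex.Im (f t))).
  exact: integrableS hi.
split; first by split.
rewrite /cintegral01 /cintegral_oo /Rintegral.
have /integrableP[mr _] := ir; have /integrableP[mi _] := ii.
by congr (fine _ +i* fine _); exact: integral_itv_bndoo.
Qed.

Lemma eq_cintegral f g : (forall t, 0 < t < 1 -> f t = g t) -> cintegral_oo f = cintegral_oo g.
Proof.
move=> fg; rewrite /cintegral_oo; congr (_ +i* _); apply: eq_Rintegral => t;
  by rewrite inE /= in_itv /= => /fg ->.
Qed.

Lemma eq_cintegrable f g : (forall t, 0 < t < 1 -> f t = g t) ->
  cintegrable_oo f -> cintegrable_oo g.
Proof.
move=> fg [hr hi]; split; [move: hr|move: hi]; apply: eq_integrable => //;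
  by move=> t; rewrite inE /= in_itv /= => /fg ->.
Qed.

Lemma cintegrableZ (c : R[i]) (g : R -> R) : mu.-integrable I01 (EFin \o g) ->
  cintegrable_oo (fun t => c * (g t)%:C) /\
  cintegral_oo (fun t => c * (g t)%:C) = c * (\int[mu]_(t in I01) g t)%:C.
Proof.
move=> ig; case: c => a b.
have E (t : R) : (a +i* b) * t%:C = (a * t) +i* (b * t).
  by simpc; rewrite /=; congr (_ +i* _); rewrite ?mulr0 ?subr0 ?add0r.
split.
  split.
    apply: (eq_integrable _ _ _ _ (integrableZl _ a ig)) => // t _ /=.
    by rewrite mulr0 subr0.
  apply: (eq_integrable _ _ _ _ (integrableZl _ b ig)) => // t _ /=.
  by rewrite mulr0 add0r.
rewrite E /cintegral_oo -!RintegralZl//.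
by congr (_ +i* _); apply: eq_Rintegral => t _; rewrite E.
Qed.

Lemma cintegrable_scale (a : R) f : cintegrable_oo f ->
  cintegrable_oo (fun t => a%:C * f t) /\ cintegral_oo (fun t => a%:C * f t) = a%:C * cintegral_oo f.
Proof.
move=> [fr fi]; split.
  split.
    apply: (eq_integrable _ _ _ _ (integrableZl _ a fr)) => // t _ /=.
    by rewrite ReM_real.
  apply: (eq_integrable _ _ _ _ (integrableZl _ a fi)) => // t _ /=.
  by rewrite ImM_real.
apply/eqP; rewrite eq_complex ReM_real ImM_real /= -!RintegralZl//.
apply/andP; split; apply/eqP; apply: eq_Rintegral => t _.
  by rewrite ReM_real.
by rewrite ImM_real.
Qed.

Lemma cintegrableD f g : cintegrable_oo f -> cintegrable_oo g ->
  cintegrable_oo (fun t => f t + g t) /\ cintegral_oo (fun t => f t + g t) = cintegral_oo f + cintegral_oo g.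
Proof.
move=> [fr fi] [gr gi].
have ReD t : complex.Re (f t + g t) = complex.Re (f t) + complex.Re (g t).
  by case: (f t) (g t) => [? ?] [].
have ImD t : complex.Im (f t + g t) = complex.Im (f t) + complex.Im (g t).
  by case: (f t) (g t) => [? ?] [].
split.
  split.
    apply: (eq_integrable _ _ _ _ (integrableD _ fr gr)) => // t _ /=.
    by rewrite ReD.
  apply: (eq_integrable _ _ _ _ (integrableD _ fi gi)) => // t _ /=.
  by rewrite ImD.
rewrite /cintegral_oo -[RHS]/((_ + _) +i* (_ + _)) -!RintegralD//.
by congr (_ +i* _); apply: eq_Rintegral => t _.
Qed.

Lemma cintegrable0 : cintegrable_oo (fun=> 0) /\ cintegral_oo (fun=> 0) = 0.
Proof.
split; first by split; exact: integrable0.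
by rewrite /cintegral_oo /Rintegral /= integral0.
Qed.

Lemma cintegrable_sum (I : Type) (s : seq I) (F : I -> R -> R[i]) :
  (forall i, cintegrable_oo (F i)) ->
  cintegrable_oo (fun t => \sum_(i <- s) F i t) /\
  cintegral_oo (fun t => \sum_(i <- s) F i t) = \sum_(i <- s) cintegral_oo (F i).
Proof.
move=> hF; elim: s => [|i s [IH1 IH2]].
  have [h1 h2] := cintegrable0; rewrite big_nil -h2; split.
    by apply: eq_cintegrable h1 => t _; rewrite big_nil.
  by apply: eq_cintegral => t _; rewrite big_nil.
have [h1 h2] := cintegrableD (hF i) IH1; rewrite big_cons -IH2 -h2; split.
  by apply: eq_cintegrable h1 => t _; rewrite big_cons.
by apply: eq_cintegral => t _; rewrite big_cons.
Qed.

(** The point [t0] is where [1 - x t] may vanish. *)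
Lemma Rintegral_dominated_cvg (h_ : nat -> R -> R) (h g : R -> R) (t0 : R) :
  (forall n, measurable_fun I01 (h_ n)) -> measurable_fun I01 h ->
  mu.-integrable I01 (EFin \o g) ->
  (forall t, 0 < t < 1 -> t != t0 -> h_ ^~ t @ \oo --> h t) ->
  (forall n t, 0 < t < 1 -> t != t0 -> `|h_ n t| <= g t) ->
  mu.-integrable I01 (EFin \o h) /\
  (fun n => \int[mu]_(t in I01) h_ n t) @ \oo --> \int[mu]_(t in I01) h t.
Proof.
move=> mh_ mh ig hc hb.
have ae (P : R -> Prop) : (forall t, t != t0 -> P t) -> {ae mu, forall t, P t}.
  move=> hP; exists [set t0]; split => //; first exact: lebesgue_measure_set1.
  by move=> t /= nP; apply/eqP/negPn/negP => tt0; apply: nP; exact: hP.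
have hc' : {ae mu, forall t, I01 t -> (EFin \o h_ n) t @[n --> \oo] --> (EFin \o h) t}.
  apply: ae => t tt0 /=; rewrite in_itv /= => t01.
  by apply: cvg_EFin; [exact: nearW|exact: hc].
have hb' : {ae mu, forall t n, I01 t -> (`|(EFin \o h_ n) t| <= (EFin \o g) t)%E}.
  by apply: ae => t tt0 n /=; rewrite in_itv /= => t01; rewrite lee_fin; exact: hb.
have [] := dominated_convergence _ _ _ hc' ig hb' => //.
- by move=> n; apply/measurable_EFinP; exact: mh_.
- by apply/measurable_EFinP; exact: mh.
move=> ih _ hl.
split => //; apply: fine_cvg; rewrite fineK//.
exact: integrable_fin_num.
Qed.

End ComplexIntegral.

Section ComplexDominated.
Variable R : realType.
Local Notation mu := (@lebesgue_measure R).
Local Notation I01 := `](0 : R), (1 : R)[%classic.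

Definition cmeasurable_oo (f : R -> R[i]) :=
  measurable_fun I01 (fun t => complex.Re (f t)) /\
  measurable_fun I01 (fun t => complex.Im (f t)).

Lemma cintegrable_measurable f : cintegrable_oo f -> cmeasurable_oo f.
Proof.
by move=> [/integrableP[hr _] /integrableP[hi _]]; split; apply/measurable_EFinP.
Qed.

Lemma cmeasurable_cvg (f_ : nat -> R -> R[i]) f : (forall n, cmeasurable_oo (f_ n)) ->
  (forall t, 0 < t < 1 ->
     (fun n => f_ n t : R[i]^o) @ \oo --> (f t : R[i]^o)) -> cmeasurable_oo f.
Proof.
move=> mf_ hc; split.
  apply: (measurable_fun_cvg (fun n => (mf_ n).1)) => t /=; rewrite in_itv /=.
  by move=> /hc/cvgC_ReIm[].
apply: (measurable_fun_cvg (fun n => (mf_ n).2)) => t /=; rewrite in_itv /=.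
by move=> /hc/cvgC_ReIm[].
Qed.

Lemma cintegral_dominated_cvg (f_ : nat -> R -> R[i]) f (g : R -> R) (t0 : R) :
  (forall n, cmeasurable_oo (f_ n)) -> cmeasurable_oo f -> mu.-integrable I01 (EFin \o g) ->
  (forall t, 0 < t < 1 -> t != t0 ->
     (fun n => f_ n t : R[i]^o) @ \oo --> (f t : R[i]^o)) ->
  (forall n t, 0 < t < 1 -> t != t0 -> mag (f_ n t) <= g t) ->
  cintegrable_oo f /\ (fun n => cintegral_oo (f_ n) : R[i]^o) @ \oo --> (cintegral_oo f : R[i]^o).
Proof.
move=> mf_ [mr mi] ig hc hb.
have [|n t t01 tt0|ir hr] := Rintegral_dominated_cvg (t0 := t0)
  (fun n => (mf_ n).1) mr ig.
- by move=> t t01 tt0; have /cvgC_ReIm[] := hc t t01 tt0.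
- by apply: le_trans (hb n t t01 tt0); exact: normr_Re_le.
have [|n t t01 tt0|ii hi] := Rintegral_dominated_cvg (t0 := t0)
  (fun n => (mf_ n).2) mi ig.
- by move=> t t01 tt0; have /cvgC_ReIm[] := hc t t01 tt0.
- by apply: le_trans (hb n t t01 tt0); exact: normr_Im_le.
by split => //; apply/cvgC_ReIm.
Qed.

End ComplexDominated.

(** * Polylogarithms along the segment *)

Section Polylog.
Variable R : realType.
Implicit Types (z w x : R[i]).

Lemma plog_coef_complex q n : (plog_coef R q n)%:C = (n%:R ^ q)^-1 :> R[i].
Proof. by rewrite /plog_coef fmorphV fmorphXz rmorph_nat. Qed.

Lemma polylog_term_reduced q z n : (0 < n)%N ->
  polylog_term q z n = z * reduced_term q z n.
Proof.
case: n => // n _; rewrite /polylog_term /reduced_term plog_coef_complex exprS /=.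
ring.
Qed.

Lemma polylog_reduced q z : csummable (reduced_term q z) ->
  polylog q z = z * csum (reduced_term q z).
Proof.
move=> /csumsP/(csumsZ z) h; apply: csums_csum; apply: eq_csums h => n n0.
by rewrite polylog_term_reduced.
Qed.

Lemma polylog_summable_mag q z : csummable (polylog_term q z) -> mag z <= 1.
Proof.
have [->|z0] := eqVneq z 0; first by rewrite mag0.
move=> /csumsP/(csumsZ z^-1) h; apply: (@mag_le1_of_summable _ q).
apply: (@csums_summable _ _ (z^-1 * csum (polylog_term q z))).
by apply: eq_csums h => n n0; rewrite polylog_term_reduced// mulKf.
Qed.

Lemma parallelogram z w :
  mag (z + w) ^+ 2 + mag (z - w) ^+ 2 = 2 * (mag z ^+ 2 + mag w ^+ 2).
Proof.
have sq (u : R[i]) : mag u ^+ 2 = complex.Re u ^+ 2 + complex.Im u ^+ 2.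
  by case: u => a b /=; rewrite sqr_sqrtr// addr_ge0 ?sqr_ge0.
by rewrite !sq; case: z w => [a b] [c d] /=; ring.
Qed.

(** The closed disc is strictly convex: an interior point of the segment is
    the midpoint of two distinct points of it, and the parallelogram identity
    makes its modulus less than [1]. *)
Lemma segment_in_open_disc w x : x != 0 ->
  (forall t : R, 0 < t < 1 -> mag (w * (1 - x * t%:C)) <= 1) ->
  forall t : R, 0 < t < 1 -> mag (w * (1 - x * t%:C)) < 1.
Proof.
move=> x0 h t /andP[t0 t1].
have [->|w0] := eqVneq w 0; first by rewrite mul0r mag0.
(* Half the distance to the endpoints keeps [t - e] and [t + e] inside. *)
pose e := Num.min t (1 - t) / 2.
have m0 : 0 < Num.min t (1 - t) by rewrite lt_min t0 subr_gt0.
have m1 : Num.min t (1 - t) <= t by rewrite ge_min lexx.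
have m2 : Num.min t (1 - t) <= 1 - t by rewrite ge_min lexx orbT.
have e0 : 0 < e by rewrite divr_gt0.
have e1 : e < t by rewrite /e; lra.
have e2 : e < 1 - t by rewrite /e; lra.
pose d := w * x * e%:C.
have d0 : 0 < mag d.
  rewrite lt_def mag_ge0 andbT mag_eq0 !mulf_neq0//.
  by rewrite (fmorph_eq0 (real_complex R)) gt_eqF.
have hm : mag (w * (1 - x * t%:C) + d) <= 1.
  have -> : w * (1 - x * t%:C) + d = w * (1 - x * (t - e)%:C).
    by rewrite /d rmorphB /=; ring.
  by apply: h; lra.
have hp : mag (w * (1 - x * t%:C) - d) <= 1.
  have -> : w * (1 - x * t%:C) - d = w * (1 - x * (t + e)%:C).
    by rewrite /d rmorphD /=; ring.
  by apply: h; lra.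
have := parallelogram (w * (1 - x * t%:C)) d.
have p1 : mag (w * (1 - x * t%:C) + d) ^+ 2 <= 1 by rewrite expr_le1 ?mag_ge0.
have p2 : mag (w * (1 - x * t%:C) - d) ^+ 2 <= 1 by rewrite expr_le1 ?mag_ge0.
move=> hs; rewrite ltNge; apply/negP => h1.
have h2 : 1 <= mag (w * (1 - x * t%:C)) ^+ 2 by rewrite exprn_ege1.
have h3 : 0 < mag d ^+ 2 by rewrite exprn_gt0.
lra.
Qed.

End Polylog.

(** * The identity term by term *)

Section Termwise.
Variables (R : realType) (p : int) (s : nat) (w x : R[i]).
Local Notation mu := (@lebesgue_measure R).
Local Notation I01 := `](0 : R), (1 : R)[%classic.
Local Notation z t := (w * (1 - x * t%:C)).

(** The [n]th term of [ln^s t Li_{p-1}(z) / (1 - x t)] with [z = w (1 - x t)]: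
    the factor [1 - x t] cancels against [z], leaving [w]. *)
Definition integrand_term (n : nat) (t : R) : R[i] :=
  (ln t ^+ s)%:C * (w * reduced_term (p - 1) (z t) n).

Definition prefactor : R[i] := (-1) ^+ s.+1 * x / (Gamma (s%:R + 1))%:C.

Lemma integrand_term_expand m t :
  integrand_term m.+1 t =
  \sum_(j < m.+1) (w ^+ m.+1 * (plog_coef R (p - 1) m.+1)%:C *
    ((- x) ^+ j *+ 'C(m, j))) * (ln t ^+ s * t ^+ j)%:C.
Proof.
rewrite /integrand_term /reduced_term /= exprMn.
have -> : 1 - x * t%:C = - x * t%:C + 1 by ring.
rewrite exprD1n !mulr_sumr; apply: eq_bigr => j _.
rewrite exprMn -[_ *+ _]mulr_natr -[(- x) ^+ j *+ _]mulr_natr rmorphM exprS /=.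
rewrite [(t ^+ j)%:C]rmorphXn /=; ring.
Qed.

Lemma cintegral_integrand_term m :
  cintegrable_oo (integrand_term m.+1) /\
  cintegral_oo (integrand_term m.+1) =
  \sum_(j < m.+1) (w ^+ m.+1 * (plog_coef R (p - 1) m.+1)%:C *
    ((- x) ^+ j *+ 'C(m, j))) *
    ((-1) ^+ s * (s`!%:R / j.+1%:R ^+ s.+1))%:C.
Proof.
pose c j := w ^+ m.+1 * (plog_coef R (p - 1) m.+1)%:C * ((- x) ^+ j *+ 'C(m, j)).
have h j := cintegrableZ (c j) (log_moment_integrable R s j).
have [h1 h2] := cintegrable_sum (index_enum 'I_m.+1) (fun j : 'I_m.+1 => (h j).1).
split.
  by apply: eq_cintegrable h1 => t _; rewrite integrand_term_expand.
rewrite (eq_cintegral (g := fun t => \sum_(j < m.+1) c j * (ln t ^+ s * t ^+ j)%:C)).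
  rewrite h2; apply: eq_bigr => j _.
  by rewrite (h j).2 log_moment.
by move=> t _; rewrite integrand_term_expand.
Qed.

(** Expanding [(1 - x t)^m] and integrating with [log_moment] gives a sum over
    [j], which is the one over [k = j + 1] since
    [(m + 1) C(m, j) = (j + 1) C(m + 1, j + 1)]. *)
Lemma binomial_series_term_integral n : (0 < n)%N ->
  binomial_series_term p s w x n = prefactor * cintegral_oo (integrand_term n).
Proof.
case: n => // m _; rewrite (cintegral_integrand_term m).2 /prefactor Gamma_nat.
rewrite /binomial_series_term big_add1 /= big_mkord !mulr_sumr.
apply: eq_bigr => j _; rewrite -[(- x) ^+ j *+ _]mulr_natr.
have m0 : m.+1%:R != 0 :> R[i] by rewrite pnatr_eq0.
have j0 : j.+1%:R != 0 :> R[i] by rewrite pnatr_eq0.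
have f0 : s`!%:R != 0 :> R[i] by rewrite pnatr_eq0 -lt0n fact_gt0.
have -> : (plog_coef R (p - 1) m.+1)%:C = m.+1%:R / m.+1%:R ^ p.
  by rewrite plog_coef_complex expfzDr// invfM exprN1 invrK mulrC.
have hb : m.+1%:R * 'C(m, j)%:R = j.+1%:R * 'C(m.+1, j.+1)%:R :> R[i].
  by rewrite -!natrM mul_bin_diag.
have hC : 'C(m.+1, j.+1)%:R = m.+1%:R * 'C(m, j)%:R / j.+1%:R :> R[i].
  by rewrite hb mulrAC mulfV// mul1r.
rewrite hC !(rmorphM, rmorphXn, rmorphN, rmorph1, fmorphV, rmorph_nat) /=.
have e2 : ((-1) ^+ s) * ((-1) ^+ s) = 1 :> R[i] by rewrite -exprMn mulrNN mulr1 expr1n.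
rewrite [(- x) ^+ j]exprNn !exprS.
transitivity (((-1) ^+ s * (-1) ^+ s) * (w * w ^+ m / m.+1%:R ^ p *
  (m.+1%:R * 'C(m, j)%:R / j.+1%:R * (-1 * (-1) ^+ j * (x * x ^+ j) / j.+1%:R ^+ s)))).
  by rewrite e2 [RHS]mul1r.
have mp : m.+1%:R ^ p != 0 :> R[i] by rewrite expfz_neq0.
clear hb hC; move: j.+1%:R (m.+1%:R ^ p) j0 mp => J M J0 M0.
by field; rewrite M0 f0 J0 expf_neq0.
Qed.

End Termwise.

Theorem mainTheorem3 (R : realType) (p : int) (s : nat) (w x : R[i])
  (hseries : csummable (binomial_series_term p s w x))
  (hpolylog : forall t : R, 0 < t < 1 ->
     csummable (polylog_term (p - 1) (w * (1 - x * t%:C))))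
  (hint : cintegrable01 (polylog_integrand p s w x)) :
  csum (binomial_series_term p s w x) =
  (-1) ^+ s.+1 * x / (Gamma (s%:R + 1))%:C *
    cintegral01 (polylog_integrand p s w x).
Proof.
have [x0|x0] := eqVneq x 0.
  rewrite x0 mulr0 !mul0r; apply: csums_csum.
  rewrite -[X in csums _ X](mul0r (csum (binomial_series_term p s w x))).
  have := csumsZ 0 ((csumsP _).1 hseries); apply: eq_csums => n n0.
  rewrite mul0r /binomial_series_term big_nat_cond big1 ?mulr0// => k.
  by rewrite andbT => /andP[k0 _]; rewrite expr0n gtn_eqF// mulr0 mul0r mulr0.
rewrite -/(prefactor s x).
have [hI ->] := cintegral01_open hint.
pose z (t : R) := w * (1 - x * t%:C).
have z1 t : 0 < t < 1 -> mag (z t) < 1.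
  apply: segment_in_open_disc => // u u01.
  exact: polylog_summable_mag (hpolylog u u01).
(* [H 1] is the integrand away from [t0]; [P r N] is a partial sum of [H r]. *)
pose L (r t : R) := csum (abel_term r (reduced_term (p - 1) (z t))).
pose H (r t : R) := (ln t ^+ s)%:C * (w * L r t).
pose P (r : R) N t := \sum_(1 <= n < N) r%:C ^+ n * integrand_term p s w x n t.
have intlog : lebesgue_measure.-integrable `](0 : R), (1 : R)[%classic
    (EFin \o (fun t : R => `|ln t ^+ s|)).
  have := integrable_norm (log_moment_integrable R s 0).
  by apply: eq_integrable => // t _ /=; rewrite expr0 mulr1.
have PH r t : 0 <= r -> r < 1 -> 0 < t < 1 ->
    (fun N => P r N t : R[i]^o) @ \oo --> (H r t : R[i]^o).
  move=> r0 r1 t01.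
  have := (csumsP _).1 (abel_summable (reduced_summable (p - 1) (z1 t t01)) r0 r1).
  move=> /(csumsZ w)/(csumsZ (ln t ^+ s)%:C).
  apply: eq_csums => n n0; rewrite /abel_term /integrand_term; ring.
have Pint r N : cintegrable_oo (P r N) /\
    cintegral_oo (P r N) = \sum_(1 <= n < N) r%:C ^+ n * cintegral_oo (integrand_term p s w x n).
  have h m := cintegrable_scale (r ^+ m.+1) (cintegral_integrand_term p s w x m).1.
  have [h1 h2] := cintegrable_sum (index_iota 0 N.-1) (fun m => (h m).1).
  have PE t : P r N t = \sum_(0 <= m < N.-1)
      (r ^+ m.+1)%:C * integrand_term p s w x m.+1 t.
    by rewrite /P big_add1; apply: eq_bigr => m _; rewrite rmorphXn.
  split; first by apply: eq_cintegrable h1 => t _; rewrite PE.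
  rewrite (eq_cintegral (fun t _ => PE t)) h2 big_add1; apply: eq_bigr => m _.
  by rewrite (h m).2 rmorphXn.
(* For [r < 1] the partial sums are dominated by a multiple of [|ln^s t|]. *)
have step1 r : 0 <= r -> r < 1 -> cmeasurable_oo (H r) /\
    csum (abel_term r (binomial_series_term p s w x)) =
    prefactor s x * cintegral_oo (H r).
  move=> r0 r1; have mH : cmeasurable_oo (H r).
    apply: (cmeasurable_cvg (f_ := P r)) => [N|t t01]; last exact: PH.
    exact: cintegrable_measurable (Pint r N).1.
  split => //; have [B B0 hB] := reduced_abs_bounded (p - 1) r0 r1.
  have [_ hl] : cintegrable_oo (H r) /\
      (fun N => cintegral_oo (P r N) : R[i]^o) @ \oo --> (cintegral_oo (H r) : R[i]^o).
    apply: (@cintegral_dominated_cvg _ _ _ (fun t => mag w * B * `|ln t ^+ s|) 0).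
    - by move=> N; exact: cintegrable_measurable (Pint r N).1.
    - exact: mH.
    - have h1 : lebesgue_measure.-integrable `](0 : R), (1 : R)[%classic
          (fun t : R => (mag w * B)%:E * `|ln t ^+ s|%:E)%E.
        exact: integrableZl intlog.
      exact: h1.
    - by move=> t t01 _; exact: PH.
    move=> N t t01 _.
    have -> : P r N t = (ln t ^+ s)%:C *
        (w * \sum_(1 <= n < N) abel_term r (reduced_term (p - 1) (z t)) n).
      rewrite !mulr_sumr; apply: eq_bigr => n _.
      rewrite /abel_term /integrand_term; ring.
    rewrite magM mag_real mulrC magM ler_wpM2r// ler_wpM2l ?mag_ge0//.
    apply: le_trans (hB N); apply: le_trans (mag_sum _ _ _) _.
    apply: ler_sum_nat => n /andP[n0 _].
    rewrite mag_abel_term// mag_reduced_term mulrCA ler_wpM2l ?plog_coef_ge0//.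
    rewrite -[leRHS]mulr1; apply: ler_pM; rewrite ?exprn_ge0 ?mag_ge0//.
      by rewrite ler_wiXn2l ?(ltW r1)// leq_pred.
    by rewrite exprn_ile1 ?mag_ge0// ltW// z1.
  apply: csums_csum; have hl' : csums (fun n => r%:C ^+ n *
      cintegral_oo (integrand_term p s w x n)) (cintegral_oo (H r)).
    by move: hl; rewrite /csums; under eq_fun do rewrite (Pint r _).2.
  have := csumsZ (prefactor s x) hl'; apply: eq_csums => n n0.
  by rewrite /abel_term binomial_series_term_integral// mulrCA.
(* Letting [r] tend to [1] on both sides. *)
pose r (k : nat) : R := 1 - k.+1%:R^-1.
have r0 k : 0 <= r k by rewrite subr_ge0 invf_le1 ?ltr0n// ler1n.
have r1 k : r k < 1 by rewrite gtrBl invr_gt0 ltr0n.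
have rlim : r @ \oo --> (1 : R).
  rewrite -[X in _ --> X]subr0; apply: cvgB; first exact: cvg_cst.
  exact: cvg_harmonic.
have lim1 := abel_theorem ((csumsP _).1 hseries) r0 r1 rlim.
have [C C0 hC] := polylog_abel_dominated R (p - 1).
pose t0 := complex.Re x^-1.
have nz t : t != t0 -> 1 - x * t%:C != 0.
  apply: contra => /eqP h; rewrite /t0; apply/eqP.
  have -> : x^-1 = t%:C by apply: (mulfI x0); rewrite mulfV//; apply/eqP; rewrite -subr_eq0 h.
  by [].
have integrandE t : 0 < t < 1 -> t != t0 -> polylog_integrand p s w x t =
    (ln t ^+ s)%:C * (w * csum (reduced_term (p - 1) (z t))).
  move=> t01 /nz nt; rewrite /polylog_integrand polylog_reduced; last first.
    by apply: reduced_summable; exact: z1.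
  by rewrite -/(z t) /z; field.
pose I := polylog_integrand p s w x.
have [_ lim2] : cintegrable_oo I /\
    (fun k => cintegral_oo (H (r k)) : R[i]^o) @ \oo --> (cintegral_oo I : R[i]^o).
  (* The limit [I] itself enters the dominating function. *)
  apply: (@cintegral_dominated_cvg _ _ _ (fun t => C * mag w * `|ln t ^+ s| +
      C * (`|complex.Re (I t)| + `|complex.Im (I t)|)) t0).
  - by move=> k; have [] := step1 _ (r0 k) (r1 k).
  - exact: cintegrable_measurable.
  - have [Ir Ii] := hI.
    have h1 : lebesgue_measure.-integrable `](0 : R), (1 : R)[%classic
        (fun t : R => (C * mag w)%:E * `|ln t ^+ s|%:E)%E.
      exact: integrableZl intlog.
    have h2 : lebesgue_measure.-integrable `](0 : R), (1 : R)[%classic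
        (fun t : R => `|complex.Re (I t)|%:E + `|complex.Im (I t)|%:E)%E.
      by apply: integrableD => //; [exact: integrable_norm Ir|exact: integrable_norm Ii].
    have h3 : lebesgue_measure.-integrable `](0 : R), (1 : R)[%classic
        (fun t : R => C%:E * (`|complex.Re (I t)|%:E + `|complex.Im (I t)|%:E))%E.
      exact: integrableZl h2.
    exact: integrableD h1 h3.
  - move=> t t01 tt0; rewrite /I (integrandE _ t01 tt0).
    have := abel_theorem ((csumsP _).1 (reduced_summable (p - 1) (z1 t t01))) r0 r1 rlim.
    move=> h; apply: (@cvgM R[i]^o); first exact: (@cvg_cst R[i]^o).
    by apply: (@cvgM R[i]^o); first exact: (@cvg_cst R[i]^o).
  move=> k t t01 tt0; apply: (@le_trans _ _ (C * mag w * `|ln t ^+ s| + C * mag (I t))).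
    rewrite /I (integrandE _ t01 tt0) /H !magM mag_real.
    apply: (@le_trans _ _ (`|ln t ^+ s| * (mag w * (C * (1 +
      mag (csum (reduced_term (p - 1) (z t)))))))).
      rewrite ler_wpM2l// ler_wpM2l ?mag_ge0//.
      exact: hC (z1 t t01) (r0 k) (r1 k).
    by rewrite le_eqVlt; apply/orP; left; apply/eqP; ring.
  by rewrite lerD2l ler_wpM2l// mag_le_ReIm.
have lim3 : (fun k => csum (abel_term (r k) (binomial_series_term p s w x)) : R[i]^o)
    @ \oo --> (prefactor s x * cintegral_oo (polylog_integrand p s w x) : R[i]^o).
  under eq_fun => k do rewrite (step1 _ (r0 k) (r1 k)).2.
  by apply: (@cvgM R[i]^o); first exact: (@cvg_cst R[i]^o).
exact: (@cvg_unique R[i]^o (@norm_hausdorff _ _) _ _ _ _ lim1 lim3).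
Qed.
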